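(* Let $\mathbf A_\star\in\mathbb R^{4\times2}$ be the matrix with rows $(2,0),(0,1),(1,1),(1,-1)$. Its optimal design is nondegenerate with facial condition number $\kappa=2$ (and $\nabla^2f(\mathbf p^\star)$ is positive definite on the sum-zero subspace of $\mathbb R^4$, with condition number $O(1)$ there). As $\varepsilon\to0$, on $\mathbf A_\star$: (1) the warm-start/identification loop with tolerance $c=\min\{c_0,(1/126)^2/\kappa^3\}$ followed by the restarted-FISTA facial phase returns a $(1+\varepsilon)$-John ellipsoid in $O(\log(1/\varepsilon))$ leverage-score queries; (2) with FacialNewton as the facial phase, after the same kind of $\varepsilon$-independent loop (tolerance $c_0$), a $(1+\varepsilon)$-John ellipsoid is returned in $O(\log\log(1/\varepsilon))$ Newton iterations; (3) every uniform-averaging certificate, i.e. certifying $g(\bar{\mathbf p}^{(T)})\le\varepsilon d$ for the uniform average $\bar{\mathbf p}^{(T)}=\frac1T\sum_{t\le T}\mathbf p^{(t)}$ of the iterates $\mathbf p^{(1)}=\tfrac14\mathbf 1$, $p_i^{(t+1)}=p_i^{(t)}v_i(\mathbf p^{(t)})/2$, needs $\Theta(\varepsilon^{-1})$ queries (one per iteration). (Thus averaged-iterate and last-iterate complexities are exponentially separated.)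
   Context: Setting. For $\mathbf A\in\mathbb R^{n\times d}$ of rank $d$ with rows $\mathbf a_i$ and $\mathbf p\in\mathbb R^n$, $\mathbf M(\mathbf p)=\sum_ip_i\mathbf a_i\mathbf a_i^\top$; when $\mathbf M(\mathbf p)\succ0$, $v_i(\mathbf p)=\mathbf a_i^\top\mathbf M(\mathbf p)^{-1}\mathbf a_i$ and $f(\mathbf p)=-\log\det\mathbf M(\mathbf p)$. $\Delta_n=\{\mathbf p\ge0:\sum p_i=1\}$, $\Delta_S=\{\mathbf p\in\Delta_n:\operatorname{supp}\mathbf p\subseteq S\}$, $g(\mathbf p)=\max_iv_i(\mathbf p)-d$; $\mathbf p\in\Delta_n$ is a $(1+\varepsilon)$-John ellipsoid if $\max_iv_i(\mathbf p)\le(1+\varepsilon)d$. A leverage-score query at $\mathbf w$ with $\mathbf M(\mathbf w)\succ0$ returns $(v_i(\mathbf w))_i$. An optimal design $\mathbf p^\star$ minimizes $f$ over $\Delta_n$; $f^\star=f(\mathbf p^\star)$, $S^\star=\{i:v_i(\mathbf p^\star)=d\}$, $m=|S^\star|$. It is nondegenerate if (i) $\operatorname{supp}\mathbf p^\star=S^\star$ and $\gamma_{\mathrm{sc}}=\min_{i\notin S^\star}(d-v_i(\mathbf p^\star))>0$; (ii) $\{\mathbf a_i\mathbf a_i^\top\}_{i\in S^\star}$ are linearly independent. $p^\star_{\min}=\min_{i\in S^\star}p^\star_i$. $V=\{\mathbf p:\operatorname{supp}\mathbf p\subseteq S^\star,\sum p_i=1\}$, $T^\star=\{\boldsymbol\delta:\operatorname{supp}\boldsymbol\delta\subseteq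 S^\star,\sum\delta_i=0\}$, $h$ is $f$ restricted to $\{\mathbf p\in V:\mathbf M(\mathbf p)\succ0\}$, $\widehat{\mathbf H}(\mathbf p)=((\mathbf a_i^\top\mathbf M(\mathbf p)^{-1}\mathbf a_j)^2)_{i,j\in S^\star}$, $\mu_\star=\lambda_{\min}(\widehat{\mathbf H}(\mathbf p^\star)|_{T^\star})$, $\widehat L_\star=\lambda_{\max}(\widehat{\mathbf H}(\mathbf p^\star))$, $\kappa=\widehat L_\star/\mu_\star$, $L_{\mathrm{loc}}=4\widehat L_\star$, $\kappa_{\mathrm{loc}}=9\kappa$, $\bar r=\min\{\tfrac12,\gamma_{\mathrm{sc}}/(2d),p^\star_{\min}\sqrt{\mu_\star}/2\}$, $c_0=\bar r-\log(1+\bar r)$. (For $\mathbf A_\star$: $d=2$, $\mathbf p^\star=(\tfrac13,0,\tfrac13,\tfrac13)$, $S^\star=\{1,3,4\}$, $\gamma_{\mathrm{sc}}=\tfrac12$.) Warm-start/identification loop (tolerance $c$). Start from the Kumar--Yıldırım volumetric initialization (greedily construct $d$ near-orthogonal directions, for each take the two rows extremal in that direction, and let $\mathbf p$ be uniform on these rows). While $\max_iv_i(\mathbf p)-d>c$ or $\min_{i:p_i>0}v_i(\mathbf p)<d-\gamma_{\mathrm{sc}}/2$: query $\mathbf v=\mathbf v(\mathbf p)$, let $j_+\in\arg\max_iv_i$, $j_-\in\arg\min_{i:p_i>0}v_i$; if $v_{j_+}-d\ge d-v_{j_-}$ put $\gamma=\frac{v_{j_+}-d}{d(v_{j_+}-1)}$,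 $\mathbf p\leftarrow(1-\gamma)\mathbf p+\gamma\mathbf e_{j_+}$; otherwise put $\gamma_{\max}=\frac{p_{j_-}}{1-p_{j_-}}$, $\gamma=\min\{\frac{d-v_{j_-}}{d(v_{j_-}-1)},\gamma_{\max}\}$ if $v_{j_-}>1$, $\gamma=\gamma_{\max}$ if $v_{j_-}\le1$, and $\mathbf p\leftarrow(1+\gamma)\mathbf p-\gamma\mathbf e_{j_-}$. Restarted-FISTA facial phase, from the loop's exit point $\mathbf x_0$, with $Q=\Delta_{S^\star}$: cycles of length $N=\lceil\sqrt{8\kappa_{\mathrm{loc}}}\rceil-1$, $\mathbf y_1=\mathbf x_0$, $t_1=1$, $\mathbf x_k=P_Q(\mathbf y_k-\nabla h(\mathbf y_k)/L_{\mathrm{loc}})$, $t_{k+1}=\tfrac12(1+\sqrt{1+4t_k^2})$, $\mathbf y_{k+1}=\mathbf x_k+\frac{t_k-1}{t_{k+1}}(\mathbf x_k-\mathbf x_{k-1})$, where $P_Q$ is Euclidean projection and $\nabla h(\mathbf y)$ is the orthogonal projection on $T^\star$ of $-(v_i(\mathbf y))_{i\in S^\star}$; at each cycle end return $\mathbf x_N$ if $g(\mathbf x_N)\le\varepsilon d$, else restart from $\mathbf x_0:=\mathbf x_N$. FacialNewton, from the loop's exit point: repeat: (1) query $\mathbf v=\mathbf v(\mathbf p)$; return $\mathbf p$ if $\max_iv_i-d\le\varepsilon d$. (2) Compute $\widehat{\mathbf H}=\widehat{\mathbf H}(\mathbf p)$ from queries at $\tfrac12(\mathbf p+\mathbf e_j)$,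 $j\in S^\star$, via $(\mathbf a_i^\top\mathbf M(\mathbf p)^{-1}\mathbf a_j)^2=(v_i(\mathbf p)-v_i(\mathbf p+\mathbf e_j))(1+v_j(\mathbf p))$ and $v_i(\mathbf p+\mathbf e_j)=\tfrac12v_i(\tfrac12(\mathbf p+\mathbf e_j))$. (3) Solve $\widehat{\mathbf H}\mathbf n+\nu\mathbf 1=(v_i)_{i\in S^\star}$, $\mathbf 1^\top\mathbf n=0$; $\lambda=(\sum_{i\in S^\star}v_in_i)^{1/2}$. (4) $\mathbf p\leftarrow\mathbf p+\mathbf n/(1+\lambda)$ if $\lambda>\tfrac14$, else $\mathbf p\leftarrow\mathbf p+\mathbf n$. *)

(* Defs.v *)
From HB Require Import structures.
From mathcomp Require Import all_boot all_order all_algebra.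
From mathcomp Require Import all_classical all_reals all_analysis.

Set Implicit Arguments.
Unset Strict Implicit.
Unset Printing Implicit Defensive.

Import Order.TTheory GRing.Theory Num.Theory.
Import numFieldNormedType.Exports.

Local Open Scope classical_set_scope.
Local Open Scope ring_scope.

(* Vectors of R^n are row vectors 'rV[R]_n; the rows a_i of A are the
   row vectors row i A, so that a_i a_i^T is (row i A)^T *m row i A. Vectors
   indexed by a set S of coordinates are vectors of R^n vanishing off S. *)

Section Euclidean.
Context {R : realType} {n : nat}.
Implicit Types (x y : 'rV[R]_n) (Q U : set 'rV[R]_n) (H : 'M[R]_n).

Definition dot x y : R := (x *m y^T) 0 0.

Definition basis_vec (j : 'I_n) : 'rV[R]_n := delta_mx 0 j.

Definition is_projection Q x y : Prop :=
  Q y /\ forall z, Q z -> dot (x - y) (x - y) <= dot (x - z) (x - z).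

(* Euclidean projection; the default value x is irrelevant when Q is nonempty,
   closed and convex. For a linear subspace it is the orthogonal projection. *)
Definition euclid_proj Q x : 'rV[R]_n := xget x (is_projection Q x).

Definition posdef H : Prop :=
  H^T = H /\ forall x, x != 0 -> 0 < dot (x *m H) x.

Definition posdef_on U H : Prop :=
  forall x, U x -> x != 0 -> 0 < dot (x *m H) x.

(* a is an eigenvalue of H|_U, i.e. of the compression to the linear subspace U
   of the symmetric operator H: for some nonzero x in U, x H - a x is
   orthogonal to U. *)
Definition eigenvalue_on U H (a : R) : Prop :=
  exists x, [/\ U x, x != 0 & forall y, U y -> dot (x *m H) y = a * dot x y].

Definition lambda_min U H : R := inf [set a | eigenvalue_on U H a].
Definition lambda_max U H : R := sup [set a | eigenvalue_on U H a].

Definition supported_on (S : {set 'I_n}) x : Prop :=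
  forall i, i \notin S -> x 0 i = 0.

(* Maximum and minimum of F over a nonempty set of indices. *)
Definition max_over (P : pred 'I_n) (F : 'I_n -> R) : R :=
  sup [set F i | i in [set i | P i]].
Definition min_over (P : pred 'I_n) (F : 'I_n -> R) : R :=
  inf [set F i | i in [set i | P i]].

Definition simplex : set 'rV[R]_n :=
  [set p | (forall i, 0 <= p 0 i) /\ \sum_i p 0 i = 1].

Definition face_simplex (S : {set 'I_n}) : set 'rV[R]_n :=
  [set p | simplex p /\ supported_on S p].

Definition coord_space (S : {set 'I_n}) : set 'rV[R]_n := supported_on S.

Definition sum_zero : set 'rV[R]_n := [set x | \sum_i x 0 i = 0].

Definition face_tangent (S : {set 'I_n}) : set 'rV[R]_n :=
  [set x | supported_on S x /\ \sum_i x 0 i = 0].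

End Euclidean.

Section Design.
Context {R : realType} {n d : nat}.
Variable A : 'M[R]_(n, d).
Implicit Types (p q x y w : 'rV[R]_n) (S : {set 'I_n}).

Definition info p : 'M[R]_d := \sum_i p 0 i *: ((row i A)^T *m row i A).

(* A leverage-score query is allowed only at such points. *)
Definition queryable w : Prop := posdef (info w).

(* The number a_i^T M(p)^-1 a_j. *)
Definition cross_lev p (i j : 'I_n) : R :=
  (row i A *m invmx (info p) *m (row j A)^T) 0 0.

Definition lev p : 'rV[R]_n := \row_i cross_lev p i i.

Definition fobj p : R := - ln (\det (info p)).

Definition gap p : R := max_over predT (lev p 0) - d%:R.

Definition john_ellipsoid (eps : R) p : Prop :=
  [/\ simplex p, queryable p & max_over predT (lev p 0) <= (1 + eps) * d%:R].

(* f is +oo where M(q) is not positive definite, whereas fobj takes a junk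
   value there: such q are no competitors. *)
Definition optimal_design p : Prop :=
  [/\ simplex p, queryable p &
      forall q, simplex q -> queryable q -> fobj p <= fobj q].

(* Quantities attached to an optimal design p. *)

Definition Sstar p : {set 'I_n} := [set i | lev p 0 i == d%:R]%SET.

(* When every index is in Sstar p this is inf set0 = 0, where the usual
   convention would be +oo. *)
Definition gamma_sc p : R :=
  min_over [pred i | i \notin Sstar p] (fun i => d%:R - lev p 0 i).

Definition nondegenerate_design p : Prop :=
  [/\ forall i, (p 0 i != 0) = (i \in Sstar p),
      0 < gamma_sc p &
      free [seq (row i A)^T *m row i A | i <- enum (Sstar p)]].

Definition p_min p : R := min_over [pred i | i \in Sstar p] (p 0).

Definition Hhat S p : 'M[R]_n :=
  \matrix_(i, j) (if (i \in S) && (j \in S) then cross_lev p i j ^+ 2 else 0).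

Definition mu_star p : R :=
  lambda_min (face_tangent (Sstar p)) (Hhat (Sstar p) p).

Definition Lhat_star p : R :=
  lambda_max (coord_space (Sstar p)) (Hhat (Sstar p) p).

Definition kappa p : R := Lhat_star p / mu_star p.
Definition L_loc p : R := 4 * Lhat_star p.
Definition kappa_loc p : R := 9 * kappa p.

Definition rbar p : R :=
  Num.min (1 / 2) (Num.min (gamma_sc p / (2 * d%:R))
                           (p_min p * Num.sqrt (mu_star p) / 2)).

Definition c_0 p : R := rbar p - ln (1 + rbar p).

(* Kumar-Yildirim volumetric initialization: the direction b j is any nonzero
   vector orthogonal to the differences a_(hi k) - a_(lo k), k < j, already
   found, and hi j, lo j are rows extremal in the direction b j. *)
Definition ky_init p : Prop :=
  exists (b : 'I_d -> 'rV[R]_d) (hi lo : 'I_d -> 'I_n),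
  [/\ forall j, b j != 0,
      forall j k : 'I_d, (k < j)%N ->
        dot (b j) (row (hi k) A - row (lo k) A) = 0,
      forall j i, dot (b j) (row (lo j) A) <= dot (b j) (row i A)
                  <= dot (b j) (row (hi j) A) &
      let X := ([set hi j | j in 'I_d] :|: [set lo j | j in 'I_d])%SET in
      p = \row_i (if i \in X then #|X|%:R^-1 else 0)].

Definition loop_cond (gsc c : R) p : Prop :=
  c < max_over predT (lev p 0) - d%:R \/
  min_over [pred i | 0 < p 0 i] (lev p 0) < d%:R - gsc / 2.

Definition loop_update p (jp jm : 'I_n) : 'rV[R]_n :=
  let vp := lev p 0 jp in
  let vm := lev p 0 jm in
  if d%:R - vm <= vp - d%:R then
    let gamma := (vp - d%:R) / (d%:R * (vp - 1)) in
    (1 - gamma) *: p + gamma *: basis_vec jp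
  else
    let gamma_max := p 0 jm / (1 - p 0 jm) in
    let gamma := if 1 < vm
                 then Num.min ((d%:R - vm) / (d%:R * (vm - 1))) gamma_max
                 else gamma_max in
    (1 + gamma) *: p - gamma *: basis_vec jm.

(* Ties in the argmax and the argmin are broken arbitrarily. *)
Definition loop_step p q : Prop :=
  exists jp jm : 'I_n,
  [/\ forall i, lev p 0 i <= lev p 0 jp,
      0 < p 0 jm /\ (forall i, 0 < p 0 i -> lev p 0 jm <= lev p 0 i) &
      q = loop_update p jp jm].

(* The values of p s beyond the exit of the loop are unconstrained. *)
Definition loop_run (gsc c : R) (p : nat -> 'rV[R]_n) : Prop :=
  ky_init (p 0%N) /\
  forall s, loop_cond gsc c (p s) -> loop_step (p s) (p s.+1).

(* The loop exits at p k, after k iterations, hence k + 1 queries (the last one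
   for the failing test), all of them at admissible points. *)
Definition loop_exits (gsc c : R) (p : nat -> 'rV[R]_n) (k : nat) : Prop :=
  [/\ forall s, (s < k)%N -> loop_cond gsc c (p s),
      ~ loop_cond gsc c (p k) &
      forall s, (s <= k)%N -> queryable (p s)].

Definition grad_h S y : 'rV[R]_n :=
  euclid_proj (face_tangent S) (\row_i (if i \in S then - lev y 0 i else 0)).

(* fista S L x0 k is (x_k, y_(k+1), t_(k+1)). *)
Fixpoint fista S (L : R) x0 (k : nat) : 'rV[R]_n * 'rV[R]_n * R :=
  if k is k'.+1 then
    let: (x, y, t) := fista S L x0 k' in
    let x' := euclid_proj (face_simplex S) (y - L^-1 *: grad_h S y) in
    let t' := (1 + Num.sqrt (1 + 4 * t ^+ 2)) / 2 in
    (x', x' + ((t - 1) / t') *: (x' - x), t')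
  else (x0, x0, 1).

Definition cycle_length p : nat :=
  (`|Num.ceil (Num.sqrt (8 * kappa_loc p))|%N).-1.

Section Facial.
(* The optimal design on whose face the iterations take place, and epsilon. *)
Variables (pstar : 'rV[R]_n) (eps : R).
Let S := Sstar pstar.
Let N := cycle_length pstar.

Definition fista_x x0 k := (fista S (L_loc pstar) x0 k).1.1.
Definition fista_y x0 k := (fista S (L_loc pstar) x0 k).1.2.

(* A cycle queries at y_1, ..., y_N and, for the stopping test, at x_N. *)
Definition cycle_valid x0 : Prop :=
  (forall k, (k < N)%N -> queryable (fista_y x0 k)) /\ queryable (fista_x x0 N).

(* fista_returns x0 m x: the restarted-FISTA phase started at x0 returns x
   after m queries. *)
Inductive fista_returns : 'rV[R]_n -> nat -> 'rV[R]_n -> Prop :=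
| Fista_stop x0 :
    cycle_valid x0 -> gap (fista_x x0 N) <= eps * d%:R ->
    fista_returns x0 N.+1 (fista_x x0 N)
| Fista_restart x0 m x :
    cycle_valid x0 -> eps * d%:R < gap (fista_x x0 N) ->
    fista_returns (fista_x x0 N) m x ->
    fista_returns x0 (N.+1 + m) x.

(* Hhat S p as computed from the queries at p and (p + e_j) / 2, j in S, the
   second one giving v_i (p + e_j) = v_i ((p + e_j) / 2) / 2. *)
Definition half_shift p (j : 'I_n) : 'rV[R]_n := 2^-1 *: (p + basis_vec j).

Definition queried_Hhat p : 'M[R]_n :=
  \matrix_(i, j) (if (i \in S) && (j \in S)
                  then (lev p 0 i - lev (half_shift p j) 0 i / 2)
                       * (1 + lev p 0 j)
                  else 0).

Definition newton_system p (u : 'rV[R]_n) : Prop :=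
  face_tangent S u /\
  exists nu : R, forall i, i \in S ->
    \sum_j queried_Hhat p i j * u 0 j + nu = lev p 0 i.

Definition newton_update p (u : 'rV[R]_n) : 'rV[R]_n :=
  let lambda := Num.sqrt (\sum_(i in S) lev p 0 i * u 0 i) in
  if 1 / 4 < lambda then p + (1 + lambda)^-1 *: u else p + u.

(* newton_returns p m q: FacialNewton started at p returns q in its m-th
   iteration. *)
Inductive newton_returns : 'rV[R]_n -> nat -> 'rV[R]_n -> Prop :=
| Newton_stop p :
    queryable p -> gap p <= eps * d%:R -> newton_returns p 1 p
| Newton_iter p u m q :
    queryable p -> eps * d%:R < gap p ->
    (forall j, j \in S -> queryable (half_shift p j)) ->
    unique (newton_system p) u ->
    newton_returns (newton_update p u) m q ->
    newton_returns p m.+1 q.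

End Facial.

(* mult_iter t is p^(t+1). *)
Fixpoint mult_iter (t : nat) : 'rV[R]_n :=
  if t is t'.+1 then
    \row_i (mult_iter t' 0 i * lev (mult_iter t') 0 i / d%:R)
  else const_mx n%:R^-1.

(* Average of p^(1), ..., p^(T). *)
Definition uniform_avg (T : nat) : 'rV[R]_n :=
  T%:R^-1 *: \sum_(t < T) mult_iter t.

End Design.

Definition hessian {R : realType} {n : nat} (F : 'rV[R]_n -> R)
    (p : 'rV[R]_n) : 'M[R]_n :=
  \matrix_(i, j) 'D_(basis_vec i) (fun q => 'D_(basis_vec j) (F : _ -> R^o) q : R^o) p.

Definition Astar (R : realType) : 'M[R]_(4, 2) :=
  \matrix_(i, j) nth 0 (nth [::] [:: [:: 2; 0]; [:: 0; 1]; [:: 1; 1]; [:: 1; -1]] i) j.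

(* Main.v *)
(* The information matrix of A_star is 2 x 2 and its determinant D is a quadratic
   form with v_i = (d_i D) / D, so every quantity is an explicit rational function.
   - Identification loop: a non-drop step multiplies D, which stays between 1/16
     and 4/3, by a factor bounded away from 1; drop steps never decrease D and
     there are at most four more of them than non-drop steps.
   - At the exit the second row has v_1 < 7/4, hence weight 0. On the remaining
     face D = (4/3)(1 - t) and v_i = (2 - 3 x_i) / (1 - t), where x = p - p_star
     and t = (3/2)|x|^2. Gradient, FISTA and Newton steps are therefore radial:
     they only rescale x. The scalar recursions contract by 19/20 per FISTA cycle
     and send a bound b <= 1/14 on the |x_i| to b^2 per Newton iteration.
   - Averages: the weight of the second row in the average of T iterates is at
     least 1/(4T), and a gap g forces this weight to be at most 4g. Conversely
     v_i is log-convex and the products of the v_i along the iteration telescope,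
     which gives a gap at most 6/T. *)
Require Import Defs.
From mathcomp Require Import all_boot all_order all_algebra ring lra.
From mathcomp Require Import all_classical all_reals all_analysis.
Import Order.TTheory GRing.Theory Num.Theory.
Import numFieldNormedType.Exports.

Set Implicit Arguments.
Unset Strict Implicit.
Unset Printing Implicit Defensive.

Local Open Scope classical_set_scope.
Local Open Scope ring_scope.

(** * Finite extrema, Euclidean projections and 2 x 2 matrices *)

Section FiniteExtrema.
Context {R : realType} {n : nat}.
Implicit Types (P : pred 'I_n) (F : 'I_n -> R).

Lemma max_over_le P F c :
  (exists i, P i) -> (max_over P F <= c <-> forall i, P i -> F i <= c).
Proof.
move=> [i0 Pi0]; split=> [le_c i Pi|le_c].
  apply: le_trans le_c; apply: ub_le_sup; last by exists i.
  (* Any bound makes [sup] an upper bound; the sum of the absolute values is one. *)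
  exists (\sum_i `|F i|) => _ [j _ <-].
  rewrite (bigD1 j) //= (le_trans (ler_norm _)) // lerDl.
  exact: sumr_ge0.
by apply: ge_sup => [|_ [i Pi <-]]; [exists (F i0), i0 | exact: le_c].
Qed.

Lemma min_over_ge P F c :
  (exists i, P i) -> (c <= min_over P F <-> forall i, P i -> c <= F i).
Proof.
move=> [i0 Pi0]; split=> [le_c i Pi|le_c].
  apply: le_trans le_c _; apply: ge_inf; last by exists i.
  exists (- \sum_i `|F i|) => _ [j _ <-].
  rewrite lerNl (bigD1 j) //= -normrN (le_trans (ler_norm _)) // lerDl.
  exact: sumr_ge0.
by apply: lb_le_inf => [|_ [i Pi <-]]; [exists (F i0), i0 | exact: le_c].
Qed.

Lemma min_over_eq P F i0 :
  P i0 -> (forall i, P i -> F i0 <= F i) -> min_over P F = F i0.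
Proof.
move=> Pi0 le_F; apply/le_anti/andP; split.
  exact: (min_over_ge F _ (ex_intro _ i0 Pi0)).1 (lexx _) _ Pi0.
by apply/min_over_ge; [exists i0|].
Qed.

End FiniteExtrema.

Section Projections.
Context {R : realType} {n : nat}.
Implicit Types (x y z : 'rV[R]_n) (Q : set 'rV[R]_n).

Lemma dotE x y : dot x y = \sum_i x 0 i * y 0 i.
Proof. by rewrite /dot mxE; apply: eq_bigr => i _; rewrite mxE. Qed.

Lemma dot_ge0 x : 0 <= dot x x.
Proof. by rewrite dotE; apply: sumr_ge0 => i _; rewrite -expr2 sqr_ge0. Qed.

Lemma dot_eq0 x : dot x x = 0 -> x = 0.
Proof.
rewrite dotE => /eqP; rewrite psumr_eq0 => [|i _]; last by rewrite -expr2 sqr_ge0.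
move=> /allP x0; apply/rowP => i; rewrite mxE.
have := x0 i (mem_index_enum i); rewrite implyTb mulf_eq0 orbb => /eqP //.
Qed.

Lemma dot_gt0 x : x != 0 -> 0 < dot x x.
Proof. by move=> x0; rewrite lt_def dot_ge0 andbT; apply: contra_neq x0 => /dot_eq0. Qed.

Lemma dotDsqr x y :
  dot (x + y) (x + y) = dot x x + 2 * dot x y + dot y y.
Proof.
rewrite !dotE mulr_sumr -!big_split; apply: eq_bigr => i _ /=; rewrite !mxE; ring.
Qed.

(** The obtuse-angle condition gives [|x - y|^2 + |y - z|^2 <= |x - z|^2], hence minimality of [y]
    and also its uniqueness, which identifies the point picked by [xget]. *)
Lemma euclid_proj_eq Q x y :
  Q y -> (forall z, Q z -> 0 <= dot (x - y) (y - z)) -> euclid_proj Q x = y.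
Proof.
move=> Qy obtuse.
have proj_y z : Q z ->
    dot (x - y) (x - y) + dot (y - z) (y - z) <= dot (x - z) (x - z).
  move=> /obtuse; rewrite -[x - z](subrKA y) (dotDsqr (x - y) (y - z)); lra.
apply: xget_unique => [|z [Qz le_z]].
  split=> // z /proj_y; apply: le_trans; rewrite lerDl; exact: dot_ge0.
have := le_trans (proj_y z Qz) (le_z y Qy).
rewrite -subr_le0 addrAC subrr add0r => yz0.
apply/esym/eqP; rewrite -subr_eq0; apply/eqP/dot_eq0/le_anti.
by rewrite yz0 dot_ge0.
Qed.

Lemma euclid_proj_id Q x : Q x -> euclid_proj Q x = x.
Proof.
move=> Qx; apply: euclid_proj_eq => // z _.
by rewrite subrr dotE big1 // => i _; rewrite mxE mul0r.
Qed.

End Projections.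

Notation r0 := (@Ordinal 4 0 isT).
Notation r1 := (@Ordinal 4 1 isT).
Notation r2 := (@Ordinal 4 2 isT).
Notation r3 := (@Ordinal 4 3 isT).

Lemma sum_ord4 (V : nmodType) (F : 'I_4 -> V) :
  \sum_i F i = F r0 + F r1 + F r2 + F r3.
Proof.
rewrite !big_ord_recl big_ord0 addr0 !addrA.
by congr (_ + _ + _ + _); congr F; apply: val_inj.
Qed.

Lemma forall_ord4 (P : 'I_4 -> Prop) :
  P r0 -> P r1 -> P r2 -> P r3 -> forall i, P i.
Proof.
move=> P0 P1 P2 P3 [[|[|[|[|//]]]] i4]; by rewrite (bool_irrelevance i4 isT).
Qed.

Lemma forall_ord2 (P : 'I_2 -> Prop) : P 0 -> P 1 -> forall i, P i.
Proof.
by move=> P0 P1 [[|[|//]] i2]; [have -> : Ordinal i2 = 0|have -> : Ordinal i2 = 1];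
  rewrite //; apply: val_inj.
Qed.

Lemma mat2P (T : Type) (A B : 'M[T]_2) :
  A 0 0 = B 0 0 -> A 0 1 = B 0 1 -> A 1 0 = B 1 0 -> A 1 1 = B 1 1 -> A = B.
Proof.
by move=> e00 e01 e10 e11; apply/matrixP; apply: forall_ord2; apply: forall_ord2.
Qed.

Lemma sum_ord2 (V : nmodType) (F : 'I_2 -> V) : \sum_i F i = F 0 + F 1.
Proof. by rewrite !big_ord_recl big_ord0 addr0; congr (_ + F _); apply: val_inj. Qed.

Lemma det_mx2 (K : comNzRingType) (M : 'M[K]_2) :
  \det M = M 0 0 * M 1 1 - M 0 1 * M 1 0.
Proof.
rewrite (expand_det_row _ 0) sum_ord2 /cofactor !det_mx11 !mxE /=.
rewrite expr0 expr1 mul1r mulN1r mulrN.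
by congr (M _ _ * M _ _ - M _ _ * M _ _); apply: val_inj.
Qed.

Lemma invmx2 (K : fieldType) (M : 'M[K]_2) : \det M != 0 ->
  [/\ invmx M 0 0 = M 1 1 / \det M, invmx M 0 1 = - M 0 1 / \det M,
      invmx M 1 0 = - M 1 0 / \det M & invmx M 1 1 = M 0 0 / \det M].
Proof.
move=> det0.
pose N : 'M[K]_2 := \matrix_(i, j)
   (if i == 0 then if j == 0 then M 1 1 / \det M else - M 0 1 / \det M
    else if j == 0 then - M 1 0 / \det M else M 0 0 / \det M).
have N00 : N 0 0 = M 1 1 / \det M by rewrite mxE.
have N01 : N 0 1 = - M 0 1 / \det M by rewrite mxE.
have N10 : N 1 0 = - M 1 0 / \det M by rewrite mxE.
have N11 : N 1 1 = M 0 0 / \det M by rewrite mxE.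
have MN : M *m N = 1%:M.
  apply: mat2P; rewrite mxE sum_ord2 ?N00 ?N01 ?N10 ?N11 mxE /= ?mulr1n ?mulr0n;
    move: det0; rewrite det_mx2 => det0.
  - by field.
  - by field.
  - by field.
  - by field.
have -> : invmx M = N.
  have uM : M \in unitmx by rewrite unitmxE unitfE.
  by rewrite -[N](mulKmx uM) MN mulmx1.
by [].
Qed.

(** * The design space of A_star *)

Section AstarDesign.
Context {R : realType}.
Implicit Types (p q x y : 'rV[R]_4) (i j : 'I_4).

Local Notation A := (Astar R).

Definition m00 p : R := 4 * p 0 r0 + p 0 r2 + p 0 r3.
Definition m01 p : R := p 0 r2 - p 0 r3.
Definition m11 p : R := p 0 r1 + p 0 r2 + p 0 r3.
Definition detA p : R := m00 p * m11 p - m01 p ^+ 2.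

(** The number [a_i^T adj(M(p)) a_j], the numerator of [cross_lev]. *)
Definition crossN p i j : R :=
  A i 0 * A j 0 * m11 p - (A i 0 * A j 1 + A i 1 * A j 0) * m01 p
    + A i 1 * A j 1 * m00 p.

Lemma AstarE :
  (((A r0 0 = 2) * (A r0 1 = 0)) * ((A r1 0 = 0) * (A r1 1 = 1)) *
   ((A r2 0 = 1) * (A r2 1 = 1)) * ((A r3 0 = 1) * (A r3 1 = -1)))%type.
Proof. by rewrite !mxE. Qed.

Lemma infoE p :
  [/\ info A p 0 0 = m00 p, info A p 0 1 = m01 p,
      info A p 1 0 = m01 p & info A p 1 1 = m11 p].
Proof.
by rewrite /info !summxE !sum_ord4; split;
   rewrite !mxE !big_ord1 !mxE /= /m00 /m01 /m11; ring.
Qed.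

Lemma det_info p : \det (info A p) = detA p.
Proof. by rewrite det_mx2; have [-> -> -> ->] := infoE p; rewrite /detA expr2. Qed.

(** Cauchy-Binet: the coefficient of [p_i p_j] is the squared 2 x 2 minor of rows [i] and [j]. *)
Lemma detAE p : detA p =
  4 * p 0 r0 * p 0 r1 + 4 * p 0 r0 * p 0 r2 + 4 * p 0 r0 * p 0 r3
  + p 0 r1 * p 0 r2 + p 0 r1 * p 0 r3 + 4 * p 0 r2 * p 0 r3.
Proof. rewrite /detA /m00 /m01 /m11; ring. Qed.

Lemma cross_levE p i j : detA p != 0 ->
  cross_lev A p i j = crossN p i j / detA p.
Proof.
move=> det0; have := @invmx2 _ (info A p); rewrite det_info => /(_ det0).
have [-> -> -> ->] := infoE p; case=> e00 e01 e10 e11.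
rewrite /cross_lev mxE sum_ord2 !mxE !sum_ord2 !mxE e00 e01 e10 e11 /crossN.
by rewrite !mxE; field.
Qed.

Lemma levE p : detA p != 0 ->
  [/\ lev A p 0 r0 = 4 * (p 0 r1 + p 0 r2 + p 0 r3) / detA p,
      lev A p 0 r1 = (4 * p 0 r0 + p 0 r2 + p 0 r3) / detA p,
      lev A p 0 r2 = (4 * p 0 r0 + p 0 r1 + 4 * p 0 r3) / detA p &
      lev A p 0 r3 = (4 * p 0 r0 + p 0 r1 + 4 * p 0 r2) / detA p].
Proof.
move=> det0; rewrite !mxE !cross_levE // /crossN !AstarE /m00 /m01 /m11.
by split; congr (_ / _); ring.
Qed.

Lemma queryableP p : 0 < m00 p -> 0 < detA p -> queryable A p.
Proof.
move=> m00_gt0 det_gt0; have [e00 e01 e10 e11] := infoE p; split.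
  by apply: mat2P; rewrite !mxE ?e01 ?e10.
move=> x x0; rewrite dotE sum_ord2 !mxE !sum_ord2 e00 e01 e10 e11.
set a := x 0 0; set b := x 0 1.
(* Completed square: this sum is [m00 p] times the quadratic form at [(a, b)]. *)
have : 0 < (m00 p * a + m01 p * b) ^+ 2 + detA p * b ^+ 2.
  have [b0|b0] := eqVneq b 0.
    have a0 : a != 0.
      apply: contra_neq x0 => a0; apply/rowP => k; rewrite mxE.
      by case: k => [[|[|//]] k2]; [rewrite -a0|rewrite -b0]; congr (x 0 _);
        apply: val_inj.
    by rewrite b0 mulr0 addr0 expr0n mulr0 addr0 exprn_even_gt0 //= mulf_neq0 // gt_eqF.
  by apply: ltr_wpDl; [exact: sqr_ge0 | apply: mulr_gt0; rewrite // exprn_even_gt0].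
rewrite (_ : _ + _ = m00 p * ((a * m00 p + b * m01 p) * a + (a * m01 p + b * m11 p) * b)).
  by rewrite pmulr_rgt0.
rewrite /detA; ring.
Qed.

Lemma simplexE p : simplex p <->
  [/\ 0 <= p 0 r0, 0 <= p 0 r1, 0 <= p 0 r2, 0 <= p 0 r3 &
      p 0 r0 + p 0 r1 + p 0 r2 + p 0 r3 = 1].
Proof.
rewrite /simplex /= sum_ord4; split=> [[p0 p1]|[p0 p1 p2 p3 p4]].
  by split=> //; exact: p0.
by split=> //; apply: forall_ord4.
Qed.

Lemma simplex_queryable p : simplex p -> 0 < detA p -> queryable A p.
Proof.
move=> /simplexE[p0 p1 p2 p3 _] det_gt0; apply: queryableP => //.
rewrite lt_def (_ : 0 <= m00 p) ?andbT; last by rewrite /m00; lra.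
apply: contraTneq det_gt0; rewrite /detA => ->.
by rewrite mul0r add0r -leNgt oppr_le0 sqr_ge0.
Qed.

(** Euler's identity for the quadratic form [detA]; equivalently, the trace of [M^-1 M] is 2. *)
Lemma sum_p_lev p : detA p != 0 ->
  p 0 r0 * lev A p 0 r0 + p 0 r1 * lev A p 0 r1 + p 0 r2 * lev A p 0 r2
  + p 0 r3 * lev A p 0 r3 = 2.
Proof.
move=> det0; have [-> -> -> ->] := levE det0.
by move: det0; rewrite detAE => det0; field.
Qed.

Lemma simplex_le1 p i : simplex p -> p 0 i <= 1.
Proof. by case/simplexE => *; move: i; apply: forall_ord4; lra. Qed.

End AstarDesign.

(** * The optimal design *)

Section Optimum.
Context {R : realType}.
Implicit Types (p q x y : 'rV[R]_4) (i j : 'I_4).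

Local Notation A := (Astar R).

Definition popt : 'rV[R]_4 := \row_i (if i == r1 then 0 else 3^-1).

Lemma poptE : ((popt 0 r0 = 3^-1) * (popt 0 r1 = 0) * (popt 0 r2 = 3^-1)
  * (popt 0 r3 = 3^-1))%type.
Proof. by rewrite !mxE. Qed.

Lemma detA_popt : detA popt = 4 / 3.
Proof. by rewrite detAE !poptE; field. Qed.

(** On the simplex [detA p = 4/3 - (3 p_0 - 1)^2 / 3 - p_1 (1 - p_0) - (p_2 - p_3)^2]. *)
Lemma detA_le p : simplex p -> detA p <= 4 / 3.
Proof.
move=> /simplexE[]; rewrite detAE.
set a := p 0 r0; set b := p 0 r1; set c := p 0 r2; set d := p 0 r3 => a0 b0 c0 d0 s1.
have := sqr_ge0 (c - d); have := sqr_ge0 (3 * a - 1).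
have := mulr_ge0 b0 (_ : 0 <= 1 - a); have -> : d = 1 - a - b - c by lra.
have : 0 <= 1 - a by lra.
nra.
Qed.

(** Equality forces the three nonnegative terms subtracted from [4/3] in the identity behind
    [detA_le] to vanish one after the other. *)
Lemma detA_max_unique p : simplex p -> 4 / 3 <= detA p -> p = popt.
Proof.
move=> /simplexE[]; rewrite detAE => a0 b0 c0 d0 s1 max_p.
suff [e0 e1 e2 e3] : [/\ p 0 r0 = 3^-1, p 0 r1 = 0, p 0 r2 = 3^-1 & p 0 r3 = 3^-1].
  by apply/rowP; apply: forall_ord4; rewrite !poptE.
move: a0 b0 c0 d0 s1 max_p.
set a := p 0 r0; set b := p 0 r1; set c := p 0 r2; set d := p 0 r3 => a0 b0 c0 d0 s1.
have ed : d = 1 - a - b - c by lra.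
have le1 : 0 <= 1 - a by lra.
have b_ge0 := mulr_ge0 b0 le1.
have sq1 := sqr_ge0 (c - d); have sq2 := sqr_ge0 (3 * a - 1).
rewrite ed in sq1 *; move=> max_p.
have e2 : (3 * a - 1) ^+ 2 = 0 by nra.
have ea : a = 3^-1 by move/eqP: e2; rewrite sqrf_eq0 => /eqP; lra.
subst a.
have eb : b = 0 by rewrite ea in b_ge0 sq1 max_p *; nra.
have e3 : (c - (1 - 3^-1 - b - c)) ^+ 2 = 0 by rewrite ea in sq1 max_p *; nra.
have ec : c = 1 - 3^-1 - b - c by move/eqP: e3; rewrite sqrf_eq0 => /eqP; lra.
by rewrite ea; split; lra.
Qed.

Lemma simplex_popt : simplex popt.
Proof. by apply/simplexE; rewrite !poptE; split; lra. Qed.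

Lemma optimal_popt : optimal_design A popt.
Proof.
have D_gt0 : 0 < detA popt by rewrite detA_popt; lra.
split; [exact: simplex_popt | exact: simplex_queryable simplex_popt _|].
move=> q sq _; rewrite /fobj !det_info lerN2.
(* For [detA q <= 0], [ln] has the default value 0, which is still below [ln (4/3)]. *)
have [Dq|Dq] := ltP 0 (detA q).
  by rewrite ler_ln ?posrE // detA_popt detA_le.
by rewrite (ln0 Dq) ln_ge0 // detA_popt; lra.
Qed.

Lemma optimal_uniq p : optimal_design A p -> p = popt.
Proof.
move=> [sp _ /(_ popt simplex_popt)].
have D_gt0 : 0 < detA popt by rewrite detA_popt; lra.
move=> /(_ (simplex_queryable simplex_popt D_gt0)); rewrite /fobj !det_info lerN2.
(* Strict positivity excludes that [p] matches the optimal value through the default [ln x = 0] for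
   [x <= 0]. *)
have ln_gt0 : 0 < ln (detA popt) by rewrite ln_gt0 // detA_popt; lra.
move=> le_ln; apply: detA_max_unique => //; rewrite -detA_popt.
have [Dp|Dp] := ltP 0 (detA p); first by rewrite -ler_ln ?posrE.
by move: le_ln; rewrite (ln0 Dp) leNgt ln_gt0.
Qed.

Lemma lev_popt : ((lev A popt 0 r0 = 2) * (lev A popt 0 r1 = 3 / 2)
  * (lev A popt 0 r2 = 2) * (lev A popt 0 r3 = 2))%type.
Proof.
have D0 : detA popt != 0 by rewrite detA_popt; apply/eqP; lra.
by have [-> -> -> ->] := levE D0; rewrite detA_popt !poptE; do !split; field.
Qed.

Lemma SstarE i : (i \in Sstar A popt) = (i != r1).
Proof.
rewrite inE; move: i; apply: forall_ord4; rewrite !lev_popt ?eqxx //.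
by apply/negbTE/eqP; lra.
Qed.

Lemma gamma_sc_popt : gamma_sc A popt = 1 / 2.
Proof.
rewrite /gamma_sc (@min_over_eq _ _ _ _ r1) /=.
- by rewrite lev_popt; lra.
- by rewrite SstarE eqxx.
- by apply: forall_ord4; rewrite SstarE.
Qed.

Lemma p_min_popt : p_min A popt = 1 / 3.
Proof.
rewrite /p_min (@min_over_eq _ _ _ _ r0) /=.
- by rewrite poptE; lra.
- by rewrite SstarE.
- by apply: forall_ord4; rewrite SstarE ?poptE.
Qed.

Lemma nondegenerate_popt : nondegenerate_design A popt.
Proof.
split.
- apply: forall_ord4; rewrite SstarE poptE ?invr_eq0 ?pnatr_eq0 ?eqxx //.
- by rewrite gamma_sc_popt; lra.
have -> : enum (Sstar A popt) = [:: r0; r2; r3].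
  rewrite /enum_mem -enumT (eq_filter (a2 := fun i => i != r1)) => [|i]; last exact: SstarE.
  have -> : enum 'I_4 = [:: r0; r1; r2; r3] by apply: (inj_map val_inj); rewrite val_enum_ord.
  by [].
pose a (i : 'I_4) := (row i A)^T *m row i A.
change (is_true (free [tuple a r0; a r2; a r3])).
apply/freeP => k; rewrite !big_ord_recl big_ord0 addr0 /=.
set k0 := k _; set k1 := k _; set k2 := k _ => /matrixP e.
have aE i u v : a i u v = A i u * A i v by rewrite mxE big_ord1 !mxE.
(* The entries read [4 k0 + k1 + k2 = 0], [k1 - k2 = 0] and [k1 + k2 = 0]. *)
clearbody a; have e00 := e 0 0; have e01 := e 0 1; have e11 := e 1 1.
rewrite !mxE !aE !AstarE in e00 e01 e11.
have h0 : k0 = 0 by lra.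
have h1 : k1 = 0 by lra.
have h2 : k2 = 0 by lra.
case=> [[|[|[|//]]] ?]; [rewrite -[RHS]h0|rewrite -[RHS]h1|rewrite -[RHS]h2];
  by congr (k _); apply: val_inj.
Qed.

End Optimum.

(** * The Hessian of the objective *)

Section DeriveLine.
Context {R : realType} {n : nat}.
Implicit Types (f : 'rV[R]_n -> R^o) (q v : 'rV[R]_n).

Lemma derive_line f q v : 'D_v f q = 'D_1 (fun h : R => f (h *: v + q) : R^o) 0.
Proof.
rewrite /derive; set d := (X in lim (X @ _)); set d' := (X in _ = lim (X @ _)).
rewrite (_ : d = d') //; apply/funext => h.
by rewrite /d /d' /= scale0r add0r addr0 [_%:A]mulr1.
Qed.

Lemma is_derive_affine (c0 c1 : R) :
  is_derive (0 : R) 1 (fun h : R => c0 + h * c1 : R^o) c1.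
Proof.
rewrite (_ : (fun h => _) = cst c0 + c1 *: (id : R -> R^o)); last first.
  by apply/funext => h; rewrite fctE /= mulrC.
have did : is_derive (0 : R) 1 (id : R -> R^o) 1 by exact: is_derive_id.
have dcst : is_derive (0 : R) 1 (cst c0 : R -> R^o) 0 by exact: is_derive_cst.
have := is_deriveD dcst (is_deriveZ c1 did).
by rewrite add0r [_ *: _]mulr1; apply.
Qed.

Lemma is_derive_ln_affine (c0 c1 : R) : 0 < c0 ->
  is_derive (0 : R) 1 (fun h : R => - ln (c0 + h * c1) : R^o) (- (c1 / c0)).
Proof.
move=> c0_gt0; apply: is_deriveN.
have dl : is_derive (c0 + 0 * c1) 1 (@ln R) c0^-1.
  by rewrite mul0r addr0; exact: is_derive1_ln.
have := @is_derive1_comp R (@ln R) (fun h => c0 + h * c1) 0 _ _ dl (is_derive_affine c0 c1).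
rewrite mulrC => H; exact: H.
Qed.

Lemma is_derive_affine_ratio (n0 n1 c0 c1 : R) : c0 != 0 ->
  is_derive (0 : R) 1 (fun h : R => - ((n0 + h * n1) / (c0 + h * c1)) : R^o)
    (n0 * c1 / c0 ^+ 2 - n1 / c0).
Proof.
move=> c0_neq0.
have dn := is_derive_affine n0 n1; have dc := is_derive_affine c0 c1.
have c_neq0 : c0 + 0 * c1 != 0 by rewrite mul0r addr0.
have dV := @is_deriveV R (fun h => c0 + h * c1) 0 c1 1 c_neq0 dc.
apply: (is_derive_eq (is_deriveN (is_deriveM dn dV))).
by rewrite /GRing.scale /= !mul0r !addr0; field.
Qed.

Lemma near_affine_gt0 (c0 c1 : R) : 0 < c0 -> \forall h \near (0 : R), 0 < c0 + h * c1.
Proof.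
move=> c0_gt0; near=> h.
have c1_gt0 : 0 < 1 + `|c1| by rewrite ltr_wpDr.
have : `|h| < c0 / (1 + `|c1|).
  near: h; apply: (@pseudometric_normed_Zmodule.nbhs0_lt R R).
  by rewrite divr_gt0.
rewrite ltr_pdivlMr // mulrDr mulr1 -normrM => h_lt.
have h1 := ler_norm (- (h * c1)); have h2 := normr_ge0 h.
rewrite normrN in h1; lra.
Unshelve. all: by end_near. Qed.

End DeriveLine.

Section Hessian.
Context {R : realType}.
Implicit Types (p q x y : 'rV[R]_4) (i j : 'I_4).

Local Notation A := (Astar R).

(** Squared 2 x 2 minors: by Cauchy-Binet these are the constant second derivatives of [detA], so
    that [grad_det q j] below is its [j]-th partial derivative. *)
Definition wedge2 i j : R := (A i 0 * A j 1 - A i 1 * A j 0) ^+ 2.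

Definition grad_det q j : R :=
  q 0 r0 * wedge2 r0 j + q 0 r1 * wedge2 r1 j + q 0 r2 * wedge2 r2 j + q 0 r3 * wedge2 r3 j.

Lemma wedge2E : [/\
  [/\ wedge2 r0 r0 = 0, wedge2 r0 r1 = 4, wedge2 r0 r2 = 4 & wedge2 r0 r3 = 4],
  [/\ wedge2 r1 r0 = 4, wedge2 r1 r1 = 0, wedge2 r1 r2 = 1 & wedge2 r1 r3 = 1],
  [/\ wedge2 r2 r0 = 4, wedge2 r2 r1 = 1, wedge2 r2 r2 = 0 & wedge2 r2 r3 = 4] &
  [/\ wedge2 r3 r0 = 4, wedge2 r3 r1 = 1, wedge2 r3 r2 = 4 & wedge2 r3 r3 = 0]].
Proof. by rewrite /wedge2 !AstarE; do !split; ring. Qed.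

(** There is no term in [h^2] because [wedge2 i i = 0]: [detA] is affine along coordinate
    directions. *)
Lemma detA_line (h : R) i q :
  detA (h *: basis_vec i + q) = detA q + h * grad_det q i.
Proof.
rewrite !detAE /grad_det /wedge2 !mxE /=.
by move: i; apply: forall_ord4 => /=; ring.
Qed.

Lemma grad_det_line (h : R) i j q :
  grad_det (h *: basis_vec i + q) j = grad_det q j + h * wedge2 i j.
Proof.
by rewrite /grad_det !mxE /=; move: i; apply: forall_ord4 => /=; ring.
Qed.

Lemma derive_fobj q j : 0 < detA q ->
  'D_(basis_vec j) (fobj A : _ -> R^o) q = - (grad_det q j / detA q).
Proof.
move=> Dq; rewrite derive_line.
under eq_fun do rewrite /fobj det_info detA_line.
exact: (@derive_val _ _ _ _ _ _ _ (is_derive_ln_affine _ Dq)).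
Qed.

Lemma hessianE i j p : 0 < detA p -> hessian (fobj A) p i j =
  grad_det p i * grad_det p j / detA p ^+ 2 - wedge2 i j / detA p.
Proof.
move=> Dp; rewrite mxE derive_line.
(* The closed form of the inner derivative is available only where [detA] is positive, hence only
   for [h] near 0. *)
rewrite (near_eq_derive (g := fun h : R => - ((grad_det p j + h * wedge2 i j) /
   (detA p + h * grad_det p i)) : R^o)).
  rewrite (@derive_val _ _ _ _ _ _ _ (is_derive_affine_ratio _ _ _ _)) ?gt_eqF //.
  by congr (_ / _ - _); rewrite mulrC.
near=> h; rewrite derive_fobj detA_line ?grad_det_line //.
by near: h; exact: near_affine_gt0.
Unshelve. all: by end_near. Qed.

End Hessian.

(** * Spectra and constants at the optimal design *)

Section Spectrum.
Context {R : realType} {n : nat}.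
Implicit Types (U : set 'rV[R]_n) (H : 'M[R]_n) (a lo hi : R).

Lemma eigenvalue_on_bounds U H lo hi a :
  (forall x, U x -> lo * dot x x <= dot (x *m H) x <= hi * dot x x) ->
  eigenvalue_on U H a -> lo <= a <= hi.
Proof.
move=> bH [x [Ux x0 /(_ x Ux) e]]; move: (bH x Ux); rewrite e.
by rewrite !ler_pM2r ?dot_gt0.
Qed.

Lemma lambda_min_eq U H a :
  eigenvalue_on U H a -> (forall x, U x -> a * dot x x <= dot (x *m H) x) ->
  lambda_min U H = a.
Proof.
move=> ea bH.
have lb b : eigenvalue_on U H b -> a <= b.
  move=> [x [Ux x0 /(_ x Ux) e]]; move: (bH x Ux); rewrite e.
  by rewrite ler_pM2r ?dot_gt0.
apply/le_anti/andP; split; last by apply: lb_le_inf; [exists a|exact: lb].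
by apply: ge_inf => //; exists a; exact: lb.
Qed.

Lemma lambda_max_eq U H a :
  eigenvalue_on U H a -> (forall x, U x -> dot (x *m H) x <= a * dot x x) ->
  lambda_max U H = a.
Proof.
move=> ea bH.
have ub b : eigenvalue_on U H b -> b <= a.
  move=> [x [Ux x0 /(_ x Ux) e]]; move: (bH x Ux); rewrite e.
  by rewrite ler_pM2r ?dot_gt0.
apply/le_anti/andP; split; first by apply: ge_sup; [exists a|exact: ub].
by apply: ub_le_sup => //; exists a; exact: ub.
Qed.

(** The existence of some eigenvalue keeps [inf] and [sup] away from the empty set. *)
Lemma lambda_bounds U H lo hi :
  (exists a, eigenvalue_on U H a) ->
  (forall x, U x -> lo * dot x x <= dot (x *m H) x <= hi * dot x x) ->
  lo <= lambda_min U H /\ lambda_max U H <= hi.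
Proof.
move=> ea bH; split; [apply: lb_le_inf|apply: ge_sup] => // a;
  by move=> /(eigenvalue_on_bounds bH) /andP[].
Qed.

End Spectrum.

(** * Curvature constants and conditioning at the optimum *)

Section Constants.
Context {R : realType}.
Implicit Types (p q x y : 'rV[R]_4) (i j : 'I_4).

Local Notation A := (Astar R).
Local Notation pst := (@popt R).
Local Notation S := (Sstar A pst).

Lemma dot4 x y :
  dot x y = x 0 r0 * y 0 r0 + x 0 r1 * y 0 r1 + x 0 r2 * y 0 r2 + x 0 r3 * y 0 r3.
Proof. by rewrite dotE sum_ord4. Qed.

Lemma mulrow4 x (H : 'M[R]_4) j :
  (x *m H) 0 j = x 0 r0 * H r0 j + x 0 r1 * H r1 j + x 0 r2 * H r2 j + x 0 r3 * H r3 j.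
Proof. by rewrite mxE sum_ord4. Qed.

Lemma supportedE x : supported_on S x <-> x 0 r1 = 0.
Proof.
split=> [sx|x1 i]; first by apply: sx; rewrite SstarE.
by rewrite SstarE negbK => /eqP ->.
Qed.

Lemma face_tangentE x :
  face_tangent S x <-> x 0 r1 = 0 /\ x 0 r0 + x 0 r2 + x 0 r3 = 0.
Proof.
rewrite /face_tangent /= sum_ord4; split=> [[/supportedE x1 s0]|[x1 s0]].
  by split=> //; rewrite -s0 x1 addr0.
by split; [exact/supportedE | rewrite x1 addr0].
Qed.

Lemma detA_popt_neq0 : detA pst != 0.
Proof. by rewrite detA_popt; apply/eqP; lra. Qed.

Lemma Hhat_popt i j : Hhat A S pst i j =
  if (i != r1) && (j != r1) then if i == j then 4 else 1 else 0.
Proof.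
rewrite mxE !SstarE cross_levE ?detA_popt_neq0 // /crossN /m00 /m01 /m11 detA_popt !poptE.
move: i j; apply: forall_ord4; apply: forall_ord4 => //=; rewrite ?AstarE; by field.
Qed.

(** On the optimal face [Hhat] is [3 I + J] with [J] the all-ones matrix: its eigenvalues are 3 on
    sum-zero vectors and [3 + 3 = 6] on the all-ones vector. *)
Lemma Hhat_form x y : x 0 r1 = 0 -> y 0 r1 = 0 -> dot (x *m Hhat A S pst) y =
  3 * dot x y + (x 0 r0 + x 0 r2 + x 0 r3) * (y 0 r0 + y 0 r2 + y 0 r3).
Proof.
by move=> x1 y1; rewrite !dot4 !mulrow4 !Hhat_popt /= x1 y1; ring.
Qed.

Lemma mu_star_popt : mu_star A pst = 3.
Proof.
apply: lambda_min_eq => [|x /face_tangentE[x1 s0]]; last first.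
  by rewrite Hhat_form // s0 mul0r addr0.
exists (basis_vec r2 - basis_vec r3); split.
- by apply/face_tangentE; rewrite !mxE /=; split; ring.
- apply/eqP => /rowP /(_ r2); rewrite !mxE /= subr0 => /eqP; by rewrite oner_eq0.
- move=> y /face_tangentE[y1 s0]; rewrite Hhat_form // ?s0 ?mulr0 ?addr0 //.
  by rewrite !mxE /= subrr.
Qed.

Lemma Lhat_star_popt : Lhat_star A pst = 6.
Proof.
apply: lambda_max_eq => [|x /supportedE x1]; last first.
  rewrite Hhat_form // dot4 x1; set a := x 0 r0; set b := x 0 r2; set c := x 0 r3.
  have := sqr_ge0 (a - b); have := sqr_ge0 (a - c); have := sqr_ge0 (b - c); nra.
exists (basis_vec r0 + basis_vec r2 + basis_vec r3); split.
- by apply/supportedE; rewrite !mxE /=; ring.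
- apply/eqP => /rowP /(_ r2); rewrite !mxE /= addr0 add0r => /eqP; by rewrite oner_eq0.
- move=> y /supportedE y1; rewrite Hhat_form ?dot4 //; rewrite !mxE /= ?y1; ring.
Qed.

Lemma kappa_popt : kappa A pst = 2.
Proof. by rewrite /kappa mu_star_popt Lhat_star_popt; field. Qed.

Lemma L_loc_popt : L_loc A pst = 24.
Proof. by rewrite /L_loc Lhat_star_popt; ring. Qed.

Lemma cycle_length_popt : cycle_length A pst = 11%N.
Proof.
rewrite /cycle_length /kappa_loc kappa_popt.
rewrite (_ : 8 * (9 * 2) = 12 ^+ 2 :> R); last by ring.
by rewrite sqrtr_sqr ger0_norm // -[12]/((12%:Z)%:~R) intrKceil.
Qed.

Lemma rbar_popt : rbar A pst = 1 / 8.
Proof.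
rewrite /rbar mu_star_popt gamma_sc_popt p_min_popt.
(* The third term of the minimum, [sqrt 3 / 6], exceeds [1/8], the value of the second one. *)
have sqrt3 : 1 <= Num.sqrt 3 :> R by rewrite -[X in X <= _]sqrtr1 ler_sqrt; lra.
rewrite (min_idPl (_ : 1 / 2 / (2 * 2) <= _)); last by lra.
by rewrite (min_idPr _); [field | lra].
Qed.

Lemma c_0_popt_gt0 : 0 < c_0 A pst.
Proof.
rewrite /c_0 rbar_popt subr_gt0 -ltr_expR lnK ?posrE; last lra.
by apply: expR_gt1Dx; apply/eqP; lra.
Qed.

(** From [ln (8/9) <= -1/9] one gets [c_0 <= 1/8 - 1/9 = 1/72], the tolerance bound on which all
    later exit estimates rest. *)
Lemma c_0_popt_le : c_0 A pst <= 1 / 72.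
Proof.
rewrite /c_0 rbar_popt.
have e : (1 + 1 / 8)^-1 = 8 / 9 :> R by field.
have : ln (8 / 9 : R) <= 8 / 9 - 1.
  by have := @le_ln1Dx R (8 / 9 - 1); rewrite subrKC; apply; lra.
by rewrite -e lnV ?posrE; lra.
Qed.

Lemma grad_det_popt j : grad_det pst j = lev A pst 0 j * detA pst.
Proof.
have [[a0 a1 a2 a3] [b0 b1 b2 b3] [c0 c1 c2 c3] [d0 d1 d2 d3]] := @wedge2E R.
rewrite /grad_det !poptE detA_popt.
by move: j; apply: forall_ord4; rewrite lev_popt ?a0 ?a1 ?a2 ?a3 ?b0 ?b1 ?b2 ?b3
  ?c0 ?c1 ?c2 ?c3 ?d0 ?d1 ?d2 ?d3; field.
Qed.

Lemma hessian_popt i j :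
  hessian (fobj A) pst i j = lev A pst 0 i * lev A pst 0 j - wedge2 i j * (3 / 4).
Proof.
have D0 := detA_popt_neq0; rewrite hessianE; last by rewrite detA_popt; lra.
by rewrite !grad_det_popt detA_popt; field.
Qed.

Lemma hessian_form x y : dot (x *m hessian (fobj A) pst) y =
  4 * x 0 r0 * y 0 r0 + 9 / 4 * x 0 r1 * y 0 r1 + 4 * x 0 r2 * y 0 r2 + 4 * x 0 r3 * y 0 r3
  + (x 0 r0 * y 0 r2 + x 0 r2 * y 0 r0) + (x 0 r0 * y 0 r3 + x 0 r3 * y 0 r0)
  + 9 / 4 * (x 0 r1 * y 0 r2 + x 0 r2 * y 0 r1) + 9 / 4 * (x 0 r1 * y 0 r3 + x 0 r3 * y 0 r1)
  + (x 0 r2 * y 0 r3 + x 0 r3 * y 0 r2).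
Proof.
have [[a0 a1 a2 a3] [b0 b1 b2 b3] [c0 c1 c2 c3] [d0 d1 d2 d3]] := @wedge2E R.
rewrite dot4 !mulrow4 !hessian_popt !lev_popt.
rewrite a0 a1 a2 a3 b0 b1 b2 b3 c0 c1 c2 c3 d0 d1 d2 d3; by field.
Qed.

(** With [s = x_2 + x_3] and [x_1] eliminated, the form is [25/4 x_0^2 + 2 x_0 s + s^2 / 4 + 3/2
    (x_2 - x_3)^2], which is positive definite; the constants are crude. *)
Lemma hessian_bounds x : sum_zero x ->
  1 / 20 * dot x x <= dot (x *m hessian (fobj A) pst) x <= 15 * dot x x.
Proof.
rewrite /sum_zero /= sum_ord4 hessian_form dot4.
set a := x 0 r0; set b := x 0 r1; set c := x 0 r2; set d := x 0 r3 => s0.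
have -> : b = - a - c - d by lra.
have h1 := sqr_ge0 (c - d); have h2 := sqr_ge0 (2 * a + (c + d) / 2).
have h3 := sqr_ge0 (c + d); have h4 := sqr_ge0 a.
have h5 := sqr_ge0 c; have h6 := sqr_ge0 d.
have h7 := sqr_ge0 (19 / 10 * (c + d) / 2 + 123/ 40 * a).
by apply/andP; split; nra.
Qed.

Lemma hessian_eigen : eigenvalue_on sum_zero (hessian (fobj A) pst) 3.
Proof.
exists (basis_vec r2 - basis_vec r3); split.
- by rewrite /sum_zero /= sum_ord4 !mxE /=; ring.
- apply/eqP => /rowP /(_ r2); rewrite !mxE /= subr0 => /eqP; by rewrite oner_eq0.
- by move=> y _; rewrite hessian_form dot4 !mxE /=; field.
Qed.

Lemma hessian_conditioning :
  [/\ posdef_on sum_zero (hessian (fobj A) pst),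
      0 < lambda_min sum_zero (hessian (fobj A) pst) &
      lambda_max sum_zero (hessian (fobj A) pst) /
        lambda_min sum_zero (hessian (fobj A) pst) <= 300%:R].
Proof.
have [lmin lmax] := lambda_bounds (ex_intro _ _ hessian_eigen) hessian_bounds.
split; [|lra|].
- move=> x /hessian_bounds/andP[+ _] x0; apply: lt_le_trans.
  by rewrite mulr_gt0 ?dot_gt0 //; lra.
- rewrite ler_pdivrMr; lra.
Qed.

End Constants.

(** * Identification loop *)

Section Loop.
Context {R : realType}.
Implicit Types (p q x y : 'rV[R]_4) (i j : 'I_4) (c : R).

Local Notation A := (Astar R).

Definition regular p := simplex p /\ 0 < detA p.

Lemma lev_ge0 p j : regular p -> 0 <= lev A p 0 j.
Proof.
move=> [/simplexE[p0 p1 p2 p3 _] Dp]; have [e0 e1 e2 e3] := levE (lt0r_neq0 Dp).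
by move: j; apply: forall_ord4; rewrite ?e0 ?e1 ?e2 ?e3 divr_ge0 ?(ltW Dp) //; lra.
Qed.

Lemma lev_grad p j : detA p != 0 -> grad_det p j = lev A p 0 j * detA p.
Proof.
have [[a0 a1 a2 a3] [b0 b1 b2 b3] [c0 c1 c2 c3] [d0 d1 d2 d3]] := @wedge2E R.
move=> D0; have [e0 e1 e2 e3] := levE D0.
move: j; apply: forall_ord4; rewrite ?e0 ?e1 ?e2 ?e3 divfK // /grad_det ?a0 ?a1 ?a2 ?a3
  ?b0 ?b1 ?b2 ?b3 ?c0 ?c1 ?c2 ?c3 ?d0 ?d1 ?d2 ?d3; ring.
Qed.

(** Matrix determinant lemma for a rank-one update; a negative [g] covers the away steps. *)
Lemma detA_move (g : R) p j : detA p != 0 ->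
  detA ((1 - g) *: p + g *: basis_vec j)
    = detA p * ((1 - g) * (1 + g * (lev A p 0 j - 1))).
Proof.
move=> D0; rewrite addrC detA_line.
have -> : grad_det ((1 - g) *: p) j = (1 - g) * grad_det p j.
  by rewrite /grad_det !mxE; ring.
by rewrite lev_grad // !detAE !mxE; ring.
Qed.

Lemma simplex_move (g : R) p j : simplex p -> g <= 1 -> 0 <= (1 - g) * p 0 j + g ->
  simplex ((1 - g) *: p + g *: basis_vec j).
Proof.
move=> /simplexE[p0 p1 p2 p3 s1] g1 pj; apply/simplexE.
have g1' : 0 <= 1 - g by lra.
have e0 := mulr_ge0 g1' p0; have e1 := mulr_ge0 g1' p1.
have e2 := mulr_ge0 g1' p2; have e3 := mulr_ge0 g1' p3.
rewrite !mxE; split; last 1 first.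
  have -> (a b c d a' b' c' d' : R) : a + g * a' + (b + g * b') + (c + g * c') + (d + g * d')
    = (a + b + c + d) + g * (a' + b' + c' + d') by ring.
  rewrite -!mulrDr s1.
  by move: (j); apply: forall_ord4 => /=; ring.
all: by move: pj; move: j; apply: forall_ord4 => /=; lra.
Qed.

Lemma detA_ge_pair p i j : simplex p -> i != j -> p 0 i * p 0 j <= detA p.
Proof.
case/simplexE=> p0 p1 p2 p3 _; rewrite detAE.
have h01 := mulr_ge0 p0 p1; have h02 := mulr_ge0 p0 p2; have h03 := mulr_ge0 p0 p3.
have h12 := mulr_ge0 p1 p2; have h13 := mulr_ge0 p1 p3; have h23 := mulr_ge0 p2 p3.
by move: i j; apply: forall_ord4; apply: forall_ord4 => //=; lra.
Qed.

Lemma ky_init_regular p : ky_init A p -> regular p /\ 1 / 16 <= detA p.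
Proof.
case=> b [hi [lo [b0 _ ext]]]; set X := (_ :|: _)%SET => /= ep.
have hiX : hi 0 \in X by rewrite inE; apply/orP; left; apply: imset_f.
have loX : lo 0 \in X by rewrite inE; apply/orP; right; apply: imset_f.
have hilo : hi 0 != lo 0.
  (* If the two extremal rows coincided, all rows would have the same component along [b 0], which
     the four rows allow only for [b 0 = 0]. *)
  apply/eqP => e; case/eqP: (b0 0).
  have eq_lo i : dot (b 0) (row i A) = dot (b 0) (row (lo 0) A).
    by apply/le_anti; rewrite -{1}e andbC; apply: ext.
  have E i : b 0 0 0 * A i 0 + b 0 0 1 * A i 1 = dot (b 0) (row (lo 0) A).
    by rewrite -(eq_lo i) dotE sum_ord2 !mxE.
  have := E r0; have := E r1; have := E r2; have := E r3.
  rewrite !AstarE => h3 h2 h1 h0.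
  by apply/rowP; apply: forall_ord2; rewrite mxE; lra.
have X_gt0 : (0 < #|X|)%N by rewrite card_gt0; apply/set0Pn; exists (hi 0).
have XR_gt0 : 0 < #|X|%:R :> R by rewrite ltr0n.
have sp : simplex p.
  split=> [i|]; first by rewrite ep mxE; case: ifP => // _; rewrite invr_ge0 ltW.
  rewrite (eq_bigr (fun i => if i \in X then #|X|%:R^-1 else 0)) => [|i _]; last by rewrite ep mxE.
  by rewrite -big_mkcond /= sumr_const -[_ *+ _]mulr_natr mulVf // gt_eqF.
have := detA_ge_pair sp hilo; rewrite ep !mxE hiX loX -ep.
have : 1 / 4 <= (#|X|%:R)^-1 :> R.
  rewrite ler_pdivrMr // ler_pdivlMl // mulr1 (ler_nat R #|X| 4).
  by rewrite -[X in (_ <= X)%N]card_ord; exact: max_card.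
move=> X4 Dp; have Dp16 : 1 / 16 <= detA p by apply: le_trans Dp; nra.
by split=> //; split=> //; lra.
Qed.

Definition supp p : {set 'I_4} := [set i | 0 < p 0 i]%SET.

Lemma regular_lt1 p j : regular p -> p 0 j < 1.
Proof.
move=> [sp]; have [p0 p1 p2 p3 s1] := (simplexE _).1 sp.
move=> D0; rewrite lt_def simplex_le1 // andbT; apply: contraTneq D0.
rewrite detAE -leNgt => e.
have z i : i != j -> p 0 i = 0.
  by move: e; move: i j; apply: forall_ord4; apply: forall_ord4 => //= e _; lra.
move: j z {e}; apply: forall_ord4 => z;
  [rewrite (z r1) // (z r2) // (z r3) // | rewrite (z r0) // (z r2) // (z r3) //
  |rewrite (z r0) // (z r1) // (z r3) // | rewrite (z r0) // (z r1) // (z r2) //]; lra.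
Qed.

(** The product is [1 + g (d - g (1 - d))]. The bound [d / 2] expresses that [g] does not exceed the
    line-search step. *)
Lemma away_gain (d g : R) : 0 < d -> 0 < g -> g * (1 - d) <= d / 2 ->
  1 <= (1 + g) * (1 - g * (1 - d)).
Proof. by move=> d0 g0 h; have := ler_wpM2l (ltW g0) h; have := mulr_gt0 g0 d0; nra. Qed.

(** If the selected score differs from 2 by [d > c], the line-search step multiplies [detA] by
    [1 + d^2 / (4 (1 + d))] (addition) or [1 + d^2 / (4 (1 - d))] (away), both at least
    [1 + c^2 / 8]. A capped away step only guarantees that [detA] does not decrease, but it removes
    an index from the support. *)
Lemma loop_progress c p q :
  0 < c -> c <= 1 / 72 -> regular p -> loop_cond A (1 / 2) c p -> loop_step A p q ->
  regular q /\
  (((1 + c ^+ 2 / 8) * detA p <= detA q /\ (#|supp q| <= #|supp p|.+1)%N) \/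
   (detA p <= detA q /\ (#|supp q| < #|supp p|)%N)).
Proof.
move=> c0 c72 reg_p cond [jp [jm [max_p [pjm min_p] ->]]].
have [sp Dp] := reg_p; have [pge0 _] := sp; have D0 : detA p != 0 by rewrite gt_eqF.
set vp := lev A p 0 jp in max_p *; set vm := lev A p 0 jm in min_p *.
have big_gap : c < vp - 2 \/ c < 2 - vm.
  case: cond => [lt_c|lt_min].
    left; rewrite ltNge; apply/negP => le_c; move: lt_c; rewrite ltNge => /negP; apply.
    rewrite lerBlDr; apply/max_over_le => [|i _]; first by exists r0.
    by have := max_p i; lra.
  (* [7 / 4] is the threshold [2 - (1/2) / 2] of the support test, and then [2 - vm > 1/4 > c]. *)
  right; suff : vm < 7 / 4 by lra.
  rewrite ltNge; apply/negP => le_v; move: lt_min; rewrite ltNge => /negP; apply.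
  apply/min_over_ge => [|i]; first by exists jm.
  by move=> /min_p; lra.
rewrite /loop_update -/vp -/vm; case: ifPn => [add|]; last rewrite -ltNge => away.
  set d := vp - 2; have d_gt : c < d by rewrite /d; lra.
  set g := d / (2 * (vp - 1)).
  have vpE : vp - 1 = 1 + d by rewrite /d; ring.
  have g_gt0 : 0 < g by rewrite /g vpE divr_gt0 //; lra.
  have g_lt1 : g < 1 by rewrite /g vpE ltr_pdivrMr; lra.
  have sq : simplex ((1 - g) *: p + g *: basis_vec jp).
    apply: simplex_move => //; first exact: ltW.
    by apply: addr_ge0; [apply: mulr_ge0 => //; lra | exact: ltW].
  have gain : (1 + c ^+ 2 / 8) * detA p <= detA ((1 - g) *: p + g *: basis_vec jp).
    rewrite detA_move // -/vp mulrC ler_pM2l // vpE.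
    have -> : (1 - g) * (1 + g * (1 + d)) = 1 + d ^+ 2 / (4 * (1 + d)).
      by rewrite /g vpE; field; apply/eqP; lra.
    rewrite lerD2l ler_pdivlMr; last lra.
    have : c ^+ 2 <= d ^+ 2 by rewrite lerXn2r ?nnegrE; lra.
    have := mulr_gt0 c0 c0; have : c ^+ 2 * d <= d ^+ 2.
      rewrite [leRHS]expr2 ler_pM2r; last lra.
      by apply: le_trans (ltW d_gt); rewrite expr2 ger_pMl //; lra.
    by rewrite !expr2; lra.
  split; first by split=> //; apply: lt_le_trans gain; rewrite mulr_gt0 //; nra.
  left; split=> //.
  apply: leq_trans (_ : #|jp |: supp p| <= _)%N; last first.
    by rewrite cardsU1; case: (_ \notin _).
  apply/subset_leq_card/fintype.subsetP => i; rewrite !inE !mxE /=.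
  case: (i == jp) => //=; rewrite mulr0 addr0 pmulr_rgt0 //; lra.
set d := 2 - vm; have d_gt : c < d by rewrite /d; lra.
set P := p 0 jm in pjm *; have P1 : P < 1 := regular_lt1 jm reg_p.
set gmax := P / (1 - P); have gmax_gt0 : 0 < gmax by rewrite divr_gt0 // subr_gt0.
set g := (if _ then _ else _).
have -> : (1 + g) *: p - g *: basis_vec jm = (1 - (- g)) *: p + (- g) *: basis_vec jm.
  by rewrite opprK scaleNr.
have supp_q i : i != jm -> 0 < g ->
    (0 < ((1 - - g) *: p + - g *: basis_vec jm) 0 i) = (0 < p 0 i).
  move=> /negbTE ij g0; rewrite !mxE /= ij mulr0 addr0 pmulr_rgt0 //; lra.
have vmE : vm - 1 = 1 - d by rewrite /d; ring.
have simp : 0 < g -> g <= gmax -> simplex ((1 - - g) *: p + - g *: basis_vec jm).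
  move=> g0; rewrite /gmax ler_pdivlMr ?subr_gt0 // => gle.
  by apply: simplex_move => //; rewrite -?/P; nra.
(* Capped steps: either [vm <= 1], where [detA] does not decrease for any step length, or the cap is
   below the line-search step. *)
have drop : g = gmax -> (vm <= 1) || (gmax <= d / (2 * (vm - 1))) ->
  regular ((1 - - g) *: p + - g *: basis_vec jm) /\
  (detA p <= detA ((1 - - g) *: p + - g *: basis_vec jm) /\
   (#|supp ((1 - - g) *: p + - g *: basis_vec jm)| < #|supp p|)%N).
  move=> eg small; have g0 : 0 < g by rewrite eg.
  have gain : detA p <= detA ((1 - - g) *: p + - g *: basis_vec jm).
    rewrite detA_move // -/vm ler_peMr // ?(ltW Dp) // opprK mulNr vmE.
    apply: away_gain => //; first lra.
    case/orP: small => [vm1|]; first by rewrite -vmE; nra.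
    have [vm1|vm1 _] := ltP 1 vm; last by rewrite -vmE; nra.
    by rewrite -eg vmE ler_pdivlMr; rewrite -?vmE; lra.
  split; first by split; [apply: simp => //; rewrite eg | apply: lt_le_trans gain].
  split=> //; apply/proper_card/fintype.properP; split.
    apply/fintype.subsetP => i; rewrite !inE; have [->|ij] := eqVneq i jm; first by move=> _.
    by rewrite supp_q.
  exists jm; first by rewrite inE.
  rewrite inE !mxE /= eqxx mulr1 -/P -leNgt eg /gmax.
  have -> : (1 - - (P / (1 - P))) * P + - (P / (1 - P)) = 0.
    by field; apply/eqP; lra.
  by [].
rewrite {}/g in supp_q simp drop *; case: ifPn drop supp_q simp => [vm1|]; last first.
  rewrite -leNgt => vm1 drop _ _.
  by rewrite vm1 in drop; have [] := drop erefl isT => ? ?; split=> //; right.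
have [le_g|gt_g] := leP (d / (2 * (vm - 1))) gmax; last first.
  move=> drop _ _; have [] := drop erefl _; first by rewrite (ltW gt_g) orbT.
  by move=> ? ?; split=> //; right.
set g := d / _ in le_g *; move=> _ supp_q simp.
have g0 : 0 < g by rewrite divr_gt0 //; lra.
have gain : (1 + c ^+ 2 / 8) * detA p <= detA ((1 - - g) *: p + - g *: basis_vec jm).
  rewrite detA_move // -/vm mulrC ler_pM2l // vmE.
  have -> : (1 - - g) * (1 + - g * (1 - d)) = 1 + d ^+ 2 / (4 * (1 - d)).
    by rewrite /g vmE; field; apply/eqP; lra.
  rewrite lerD2l ler_pdivlMr; last lra.
  have : c ^+ 2 <= d ^+ 2 by rewrite lerXn2r ?nnegrE; lra.
  have := mulr_gt0 c0 c0; have : 0 <= c ^+ 2 * d by rewrite mulr_ge0 ?sqr_ge0; lra.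
  by rewrite !expr2; lra.
split; first by split; [exact: simp | apply: lt_le_trans gain; rewrite mulr_gt0 //; nra].
left; split=> //; apply/leqW/subset_leq_card/fintype.subsetP => i; rewrite !inE.
by have [->|ij] := eqVneq i jm => // ; rewrite supp_q.
Qed.

End Loop.

(** * Termination of the loop and its exit points *)

Section LoopTermination.
Context {R : realType}.
Implicit Types (p q x y : 'rV[R]_4) (i j : 'I_4) (c : R).

Local Notation A := (Astar R).

Lemma bernoulli (x : R) k : 0 <= x -> 1 + k%:R * x <= (1 + x) ^+ k.
Proof.
move=> x0; elim: k => [|k IH]; first by rewrite mul0r addr0 expr0.
rewrite exprS -natr1; have : 0 <= k%:R :> R by rewrite ler0n.
move: IH; set y := _ ^+ k; set m := k%:R => IH m0.
have := ler_wpM2l (_ : 0 <= 1 + x) IH; have := mulr_ge0 m0 (mulr_ge0 x0 x0); nra.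
Qed.

Lemma loop_step_exists p : regular p -> exists q, loop_step A p q.
Proof.
move=> [[p0 p1] _].
have [i0 pi0] : exists i0, 0 < p 0 i0.
  apply/existsP; apply: contraT => /existsPn pn0.
  have : \sum_i p 0 i <= 0 by apply: sumr_le0 => i _; rewrite leNgt pn0.
  by rewrite p1; lra.
have [jp _ max_p] := arg_maxP (lev A p 0) (isT : xpredT i0).
have [jm pjm min_p] := arg_minP (lev A p 0) (pi0 : [pred i | 0 < p 0 i] i0).
exists (loop_update A p jp jm), jp, jm; split=> // i; exact: max_p.
Qed.

Lemma ky_init_exists : exists p, ky_init A p.
Proof.
(* The directions are [(1, 0)], extremal at rows 0 and 1, and [(1, 2)], orthogonal to their
   difference [(2, -1)] and extremal at rows 2 and 3. *)
pose b (j : 'I_2) : 'rV[R]_2 := \row_k (if j == 0 then (k == 0)%:R else if k == 0 then 1 else 2).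
pose hi (j : 'I_2) := if j == 0 then r0 else r2.
pose lo (j : 'I_2) := if j == 0 then r1 else r3.
have bE (j : 'I_2) i : dot (b j) (row i A) = b j 0 0 * A i 0 + b j 0 1 * A i 1.
  by rewrite dotE sum_ord2 !mxE.
have dotB (x y z : 'rV[R]_2) : dot x (y - z) = dot x y - dot x z.
  by rewrite !dotE -sumrB; apply: eq_bigr => i _; rewrite !mxE mulrBr.
eexists; exists b, hi, lo; split; last by [].
- by apply: forall_ord2; apply/eqP => /rowP /(_ 0); rewrite !mxE /= => /eqP; rewrite oner_eq0.
- by apply: forall_ord2; apply: forall_ord2 => //= _;
    rewrite dotB !bE /hi /lo /= !AstarE !mxE /=; ring.
- apply: forall_ord2; apply: forall_ord4; rewrite !bE /hi /lo /= !AstarE !mxE /=;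
    apply/andP; split; lra.
Qed.

(** Shows that the quantification over all runs is not vacuous; the run built here is constant after
    its exit. *)
Lemma loop_run_exists c : 0 < c -> c <= 1 / 72 ->
  exists p : nat -> 'rV[R]_4, loop_run A (1 / 2) c p.
Proof.
move=> c0 c72; have [p0 init] := ky_init_exists.
pose step p := if `[< loop_cond A (1 / 2) c p >] then xget p (loop_step A p) else p.
have reg s : regular (iter s step p0).
  elim: s => [|s IH]; first exact: (ky_init_regular init).1.
  rewrite iterS /step; case: asboolP => // cond.
  have next := xgetPex (iter s step p0) (loop_step_exists IH).
  by have [] := loop_progress c0 c72 IH cond next.
exists (fun s => iter s step p0); split=> // s cond.
by rewrite iterS /step asboolT //; exact: (xgetPex _ (loop_step_exists (reg s))).
Qed.

(** [a] counts the steps with a gain and [b] the drops. The support starts with at most 4 indices,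
    gains at most one at each step of the first kind and loses at least one at each drop. *)
Lemma loop_invariant c (p : nat -> 'rV[R]_4) s : 0 < c -> c <= 1 / 72 -> loop_run A (1 / 2) c p ->
  (forall t, (t < s)%N -> loop_cond A (1 / 2) c (p t)) ->
  regular (p s) /\ exists a b : nat,
    [/\ (a + b = s)%N, (#|supp (p s)| + b <= 4 + a)%N &
        (1 + c ^+ 2 / 8) ^+ a / 16 <= detA (p s)].
Proof.
move=> c0 c72 [init run]; elim: s => [_|s IH cond].
  have [reg0 D0] := ky_init_regular init; split=> //; exists 0%N, 0%N.
  by split; rewrite ?expr0 // addn0 addn0 -[X in (_ <= X)%N]card_ord max_card.
have [reg_s [a [b [ab sab Da]]]] := IH (fun t ts => cond t (ltnW ts)).
have cs := cond s (ltnSn s).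
have c2 : 0 <= c ^+ 2 / 8 by rewrite divr_ge0 ?sqr_ge0.
have [reg' [[gain le_s]|[gain lt_s]]] := loop_progress c0 c72 reg_s cs (run s cs).
  split=> //; exists a.+1, b; split; first by rewrite addSn ab.
    by rewrite addnS; apply: leq_trans (_ : (#|supp (p s)| + b).+1 <= _)%N;
      rewrite ?ltnS // -addSn leq_add2r.
  apply: le_trans gain; rewrite exprS -mulrA ler_pM2l //; lra.
split=> //; exists a, b.+1; split; first by rewrite addnS ab.
  by rewrite addnS -addSn; apply: leq_trans sab; rewrite leq_add2r.
exact: le_trans gain.
Qed.

Lemma loop_terminates c : 0 < c -> c <= 1 / 72 -> exists K : nat,
  forall p : nat -> 'rV[R]_4, loop_run A (1 / 2) c p ->
  exists k, [/\ loop_exits A (1 / 2) c p k, (k <= K)%N & regular (p k)].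
Proof.
move=> c0 c72; have c2 : 0 < c ^+ 2 / 8 by rewrite divr_gt0 ?exprn_gt0.
(* By Bernoulli [1 + a c^2 / 8 <= 16 * (4/3) < 22], so [B] bounds the number [a] of gain steps; the
   drops number at most [4 + a]. *)
pose B := Num.truncn (21 / (c ^+ 2 / 8)).
have BP a : a%:R * (c ^+ 2 / 8) <= 21 -> (a <= B)%N.
  move=> h; have B0 : 0 <= 21 / (c ^+ 2 / 8) by apply: divr_ge0; [lra | exact: ltW].
  by rewrite (truncn_ge_nat _ B0) ler_pdivlMr.
exists (4 + B + B)%N => p run.
have exit : exists k, `[< ~ loop_cond A (1 / 2) c (p k) >] && (k <= 4 + B + B)%N.
  have [//|noexit] :=
    pselect (exists k, `[< ~ loop_cond A (1 / 2) c (p k) >] && (k <= 4 + B + B)%N).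
  have cond t : (t < (4 + B + B).+1)%N -> loop_cond A (1 / 2) c (p t).
    move=> tB; apply: contrapT => ncond; apply: noexit; exists t.
    by rewrite -ltnS tB andbT; apply/asboolP.
  have [[sp _] [a [b [ab sab Da]]]] := loop_invariant c0 c72 run cond.
  have aB : (a <= B)%N.
    apply: BP; have := bernoulli a (ltW c2); have := detA_le sp.
    by move: Da; lra.
  have : (a + b <= B + (4 + B))%N.
    by rewrite leq_add // (leq_trans (leq_trans (leq_addl _ _) sab)) // leq_add2l.
  by rewrite ab [(B + _)%N]addnC ltnn.
have [k /andP[/asboolP nck kB] kmin] := ex_minnP exit.
have cond t : (t < k)%N -> loop_cond A (1 / 2) c (p t).
  move=> tk; apply: contrapT => /asboolP nct.
  by have := kmin t; rewrite nct (leq_trans (ltnW tk) kB) => /(_ isT); rewrite leqNgt tk.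
have reg t : (t <= k)%N -> regular (p t).
  move=> tk; apply: (loop_invariant c0 c72 run _).1 => s st.
  by apply: cond; apply: leq_trans st tk.
exists k; split; [split=> // s sk | by [] | exact: reg].
by have [sp Dp] := reg s sk; exact: simplex_queryable.
Qed.

(* [y = 2/3 m00 / D] and [x = 2 m11 / D] satisfy [x + y <= 2 + c] (the optimal
   weights average the leverage scores) and [x y >= 1], as [D <= 4/3]. *)
Lemma lev_r1_small p c : regular p -> 0 <= c -> c <= 1 / 72 ->
  (forall i, lev A p 0 i <= 2 + c) -> lev A p 0 r1 < 7 / 4.
Proof.
move=> [sp Dp] c0 c72 le_v; have D0 : detA p != 0 by rewrite gt_eqF.
have := le_v r0; have := le_v r2; have := le_v r3; have [-> e1 -> ->] := levE D0.
rewrite e1 !ler_pdivrMr // ltr_pdivrMr //.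
have D_le := detA_le sp; have Dm : detA p = m00 p * m11 p - m01 p ^+ 2 by [].
have [q0 q1 q2 q3 _] := (simplexE _).1 sp.
rewrite -/(m00 p) => h3 h2 h0; rewrite ltNge; apply/negP => h1.
have m01_ge := sqr_ge0 (m01 p).
have m00E : m00 p = 4 * p 0 r0 + p 0 r2 + p 0 r3 by [].
have m11E : m11 p = p 0 r1 + p 0 r2 + p 0 r3 by [].
have xy : 2 * m11 p + 2 / 3 * m00 p <= (2 + c) * detA p by rewrite m00E m11E; lra.
have m00_gt0 : 0 < m00 p by lra.
have le_D : detA p <= m00 p * m11 p by rewrite Dm; lra.
have m11_le : m11 p <= (2 + 1 / 72 - 7 / 6) / 2 * detA p by nra.
have : m00 p <= (3 / 2) * (2 + 1 / 72) * detA p by nra.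
nra.
Qed.

(** A positive weight on row 1 would put its score, below [7/4] by [lev_r1_small], into the support
    test and keep the loop running. *)
Lemma exit_facial p c : regular p -> 0 <= c -> c <= 1 / 72 ->
  ~ loop_cond A (1 / 2) c p ->
  p 0 r1 = 0 /\ forall i, lev A p 0 i <= 2 + c.
Proof.
move=> reg_p c0 c72 ncond.
have le_v i : lev A p 0 i <= 2 + c.
  have : max_over predT (lev A p 0) - 2 <= c.
    by rewrite leNgt; apply/negP => h; apply: ncond; left.
  rewrite lerBlDl => /(max_over_le _ _ (ex_intro _ r0 isT)).1; exact.
split=> //; have [[pge0 _] _] := reg_p.
apply: contrapT => p1; apply: ncond; right.
have p1_gt0 : 0 < p 0 r1 by rewrite lt_def pge0 andbT; apply/eqP.
have supp1 : [pred i | 0 < p 0 i] r1 by [].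
have := (min_over_ge (lev A p 0) _ (ex_intro _ r1 supp1)).1 (lexx _) r1 supp1.
move=> /le_lt_trans; apply.
have := lev_r1_small reg_p c0 c72 le_v; lra.
Qed.

End LoopTermination.

(** * The optimal face *)

Section Face.
Context {R : realType}.
Implicit Types (p q x y z : 'rV[R]_4) (i j : 'I_4) (b c : R).

Local Notation A := (Astar R).
Local Notation pst := (@popt R).
Local Notation S := (Sstar A pst).

Definition face_ball b x := face_tangent S x /\ forall i, `|x 0 i| <= b.

Lemma ler_norm_sqr (a c : R) : 0 <= c -> a ^+ 2 <= c ^+ 2 -> `|a| <= c.
Proof. by move=> c0; rewrite -[a ^+ 2]real_normK ?num_real // ler_pXn2r ?nnegrE. Qed.

Lemma dot_face x : x 0 r1 = 0 ->
  dot x x = x 0 r0 ^+ 2 + x 0 r2 ^+ 2 + x 0 r3 ^+ 2.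
Proof. by move=> x1; rewrite dot4 x1; ring. Qed.

Lemma face_tangentZ (a : R) x : face_tangent S x -> face_tangent S (a *: x).
Proof.
move=> /face_tangentE[x1 s0]; apply/face_tangentE; rewrite !mxE x1 mulr0.
by rewrite -!mulrDr s0 mulr0.
Qed.

Lemma dotZ (a : R) x : dot (a *: x) (a *: x) = a ^+ 2 * dot x x.
Proof. by rewrite !dot4 !mxE; ring. Qed.

Lemma detA_face x : face_tangent S x ->
  detA (pst + x) = 4 / 3 * (1 - 3 / 2 * dot x x).
Proof.
move=> /face_tangentE[x1 s0]; rewrite dot_face // detAE !mxE /= x1.
have -> : x 0 r3 = - x 0 r0 - x 0 r2 by lra.
by field.
Qed.

Lemma lev_face x : face_tangent S x -> 3 / 2 * dot x x < 1 ->
  [/\ lev A (pst + x) 0 r0 = (2 - 3 * x 0 r0) / (1 - 3 / 2 * dot x x),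
      lev A (pst + x) 0 r1 = (3 / 2 + 9 / 4 * x 0 r0) / (1 - 3 / 2 * dot x x),
      lev A (pst + x) 0 r2 = (2 - 3 * x 0 r2) / (1 - 3 / 2 * dot x x) &
      lev A (pst + x) 0 r3 = (2 - 3 * x 0 r3) / (1 - 3 / 2 * dot x x)].
Proof.
move=> tx u1; have u0 : 1 - 3 / 2 * dot x x != 0 by apply/eqP; lra.
have D0 : detA (pst + x) != 0 by rewrite detA_face // mulf_neq0 //; apply/eqP; lra.
have [-> -> -> ->] := levE D0; rewrite detA_face //.
have /face_tangentE[x1 s0] := tx; have x3 : x 0 r3 = - x 0 r0 - x 0 r2 by lra.
have u2 : 2 - 3 * dot x x != 0 by apply/eqP; lra.
by rewrite !mxE /= x1 x3; split; field.
Qed.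

Lemma lev_face_in x i : face_tangent S x -> 3 / 2 * dot x x < 1 -> i \in S ->
  lev A (pst + x) 0 i = (2 - 3 * x 0 i) / (1 - 3 / 2 * dot x x).
Proof.
move=> tx u1; have [e0 _ e2 e3] := lev_face tx u1; rewrite SstarE.
by move: i; apply: forall_ord4; rewrite ?eqxx.
Qed.

Lemma face_ball_ge0 b x : face_ball b x -> 0 <= b.
Proof. by move=> [_ /(_ r0)]; exact: le_trans. Qed.

Lemma face_ball_le b c x : b <= c -> face_ball b x -> face_ball c x.
Proof. by move=> bc [tx le_x]; split=> // i; exact: le_trans (le_x i) bc. Qed.

Lemma face_ball_dot b x : face_ball b x -> dot x x <= 3 * b ^+ 2.
Proof.
move=> [/face_tangentE[x1 s0] bx]; rewrite dot_face //.
have sq i : x 0 i ^+ 2 <= b ^+ 2.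
  by rewrite -real_normK ?num_real // lerXn2r ?nnegrE // (le_trans _ (bx i)).
have := sq r0; have := sq r2; have := sq r3; lra.
Qed.

Lemma face_regular x : face_ball (1 / 14) x -> regular (pst + x).
Proof.
move=> bx; have := face_ball_dot bx; have [tx le_x] := bx.
have /face_tangentE[x1 s0] := tx.
split; last by rewrite detA_face //; lra.
have := le_x r0; have := le_x r2; have := le_x r3; rewrite !ler_norml => h3 h2 h0.
by apply/simplexE; rewrite !mxE /= x1; split; lra.
Qed.

(** On the face the numerators exceed 2 by at most [3 b], and the denominator, which differs from 1
    by a term of order [b^2], uses part of the remaining [b]. The score of row 1 stays near
    [3/2]. *)
Lemma face_gap b x : face_ball b x -> b <= 1 / 14 -> gap A (pst + x) <= 4 * b.
Proof.
move=> bx b14; have u_le := face_ball_dot bx; have [tx le_x] := bx.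
have b0 := face_ball_ge0 bx.
have dot0 := dot_ge0 x.
have b2 : b ^+ 2 <= b / 14 by rewrite expr2; nra.
have u1 : 3 / 2 * dot x x < 1 by lra.
rewrite /gap lerBlDr; apply/max_over_le => [|i _]; first by exists r0.
have := le_x r0; have := le_x r2; have := le_x r3; rewrite !ler_norml => h3 h2 h0.
have [e0 e1 e2 e3] := lev_face tx u1.
have bdot : b * dot x x <= b * (3 / 196) by rewrite ler_wpM2l //; lra.
by move: i; apply: forall_ord4; rewrite ?e0 ?e1 ?e2 ?e3 ler_pdivrMr; lra.
Qed.

Lemma john_of_gap (eps : R) p : regular p -> gap A p <= eps * 2%:R -> john_ellipsoid A eps p.
Proof.
move=> [sp Dp]; rewrite /gap lerBlDr => g; split=> //; first exact: simplex_queryable.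
lra.
Qed.

(** With [t = 3/2 |x|^2], adding the three bounds [2 - 3 x_i <= (2 + c) (1 - t)] cancels the [x_i]
    and gives [t <= c / 2 <= 1/144], so [|x|^2 < 1/196]. *)
Lemma exit_face_ball p c : regular p -> 0 <= c -> c <= 1 / 72 ->
  ~ loop_cond A (1 / 2) c p -> exists2 x, p = pst + x & face_ball (1 / 14) x.
Proof.
move=> reg_p c0 c72 ncond; have [p1 le_v] := exit_facial reg_p c0 c72 ncond.
pose x := p - pst; have px : p = pst + x by rewrite addrC subrK.
exists x => //; have [sp Dp] := reg_p.
have [_ _ _ _ s1] := (simplexE _).1 sp.
have tx : face_tangent S x by apply/face_tangentE; rewrite !mxE /=; split; lra.
have u1 : 3 / 2 * dot x x < 1 by move: Dp; rewrite px detA_face //; lra.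
have u0 : 0 < 1 - 3 / 2 * dot x x by lra.
have := le_v r0; have := le_v r2; have := le_v r3.
rewrite px; have [-> _ -> ->] := lev_face tx u1; rewrite !ler_pdivrMr // => h3 h2 h0.
have /face_tangentE[x1 s0] := tx; have dx := dot_face x1.
have cu : 0 <= c * dot x x by rewrite mulr_ge0 // dot_ge0.
have small : dot x x <= 1 / 196 by lra.
have sq i : x 0 i ^+ 2 <= dot x x.
  rewrite dx; have := sqr_ge0 (x 0 r0); have := sqr_ge0 (x 0 r2); have := sqr_ge0 (x 0 r3).
  by move: i; apply: forall_ord4; rewrite ?x1; lra.
split=> // i; apply: ler_norm_sqr; first lra.
by rewrite expr2; have := sq i; lra.
Qed.

(** The part of the scores that is constant on the face is orthogonal to the tangent space, so only
    the term in [3 x_i] survives the projection. *)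
Lemma grad_h_face x : face_tangent S x -> 3 / 2 * dot x x < 1 ->
  grad_h A S (pst + x) = (3 / (1 - 3 / 2 * dot x x)) *: x.
Proof.
move=> tx u1; apply: euclid_proj_eq; first exact: face_tangentZ.
move=> z /face_tangentE[z1 sz]; have /face_tangentE[x1 sx] := tx.
have [e0 _ e2 e3] := lev_face tx u1.
set u := 1 - _ in e0 e2 e3 *; have u0 : u != 0 by rewrite /u; apply/eqP; lra.
rewrite dot4; rewrite !mxE !SstarE /=; rewrite !mxE in e0 e2 e3; rewrite e0 e2 e3 x1 z1.
rewrite le_eqVlt; apply/orP; left; apply/eqP.
have -> : x 0 r3 = - x 0 r0 - x 0 r2 by lra.
have -> : z 0 r3 = - z 0 r0 - z 0 r2 by lra.
by field.
Qed.

End Face.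

(** * Restarted FISTA *)

Section Fista.
Context {R : realType}.
Implicit Types (p q x y z : 'rV[R]_4) (i j : 'I_4) (b c s e t : R).

Local Notation A := (Astar R).
Local Notation pst := (@popt R).
Local Notation S := (Sstar A pst).

(** In terms of [z = s + e] the energy decrease is a quadratic form in [z] and [e]. The weight 8
    makes its cross coefficient [2 (8 k - 1)], zero at [k = 1/8] and small on the given range, so
    the square terms absorb it. *)
Lemma fista_energy s e d k : e ^+ 2 <= d ^+ 2 -> 1 / 8 <= k <= 33 / 256 ->
  ((1 - k) * (s + e)) ^+ 2 + 8 * ((1 - k) * (s + e) - s) ^+ 2 <= s ^+ 2 + 8 * d ^+ 2.
Proof.
move=> ed /andP[k1 k2].
pose z := s + e; have -> : s = z - e by rewrite /z; ring.
have -> : z - e + e = z by ring.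
apply: (@le_trans _ _ ((z - e) ^+ 2 + 8 * e ^+ 2)); last lra.
rewrite -subr_ge0.
have -> : (z - e) ^+ 2 + 8 * e ^+ 2 - (((1 - k) * z) ^+ 2 + 8 * ((1 - k) * z - (z - e)) ^+ 2)
  = (2 * k - 9 * k ^+ 2) * z ^+ 2 + 2 * (8 * k - 1) * (z * e) + e ^+ 2 by ring.
have kz : 1 / 10 * z ^+ 2 <= (2 * k - 9 * k ^+ 2) * z ^+ 2.
  by rewrite ler_wpM2r ?sqr_ge0 //; nra.
have k8 : 0 <= 8 * k - 1 <= 1 / 20 by apply/andP; split; lra.
have ze : - (z ^+ 2 + e ^+ 2) <= 2 * (z * e).
  by have := sqr_ge0 (z + e); nra.
have : (8 * k - 1) * - (z ^+ 2 + e ^+ 2) <= (8 * k - 1) * (2 * (z * e)).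
  by apply: ler_wpM2l => //; lra.
have := sqr_ge0 z; have := sqr_ge0 e => e2 z2.
have : (8 * k - 1) * (z ^+ 2 + e ^+ 2) <= 1 / 20 * (z ^+ 2 + e ^+ 2).
  by apply: ler_wpM2r; lra.
lra.
Qed.

(* Starting from [popt + x], the iterates stay on the line [popt + R x]; [s] and
   [s + e] are the positions of [x_k] and [y_(k+1)] on it, and [d] is the last
   increment of [s]. The energy [s^2 + 8 d^2] does not increase, for any momentum
   coefficient in [0, 1], and the first step already brings it from [1] below
   [(19/20)^2]. *)
Definition fista_state x (r s e t : R) (st : 'rV[R]_4 * 'rV[R]_4 * R) : Prop :=
  [/\ st = (pst + s *: x, pst + (s + e) *: x, t), 1 <= t &
      exists2 d, e ^+ 2 <= d ^+ 2 & s ^+ 2 + 8 * d ^+ 2 <= r].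

(** Cauchy-Schwarz: [(s + e)^2 <= (1 + 1/8) (s^2 + 8 e^2)]. *)
Lemma fista_state_le x r s e t st : r <= 1 -> fista_state x r s e t st ->
  `|s| <= 1 /\ (s + e) ^+ 2 <= 9 / 8.
Proof.
move=> r1 [_ _ [d ed sd]]; have d2 := sqr_ge0 d; have e2 := sqr_ge0 e.
split; last by have := sqr_ge0 (s - 8 * e); nra.
by apply: ler_norm_sqr; rewrite ?expr1n; lra.
Qed.

Lemma fista_line x s e : face_ball (1 / 14) x -> (s + e) ^+ 2 <= 9 / 8 ->
  let z := (s + e) *: x in face_tangent S z /\ 3 / 2 * dot z z <= 27 / 1000.
Proof.
move=> bx se; have := face_ball_dot bx; have [tx _] := bx => dx.
split; first exact: face_tangentZ.
rewrite dotZ; have := dot_ge0 x => d0.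
have : (s + e) ^+ 2 * dot x x <= 9 / 8 * dot x x by apply: ler_wpM2r.
lra.
Qed.

(** The energy estimate is a hypothesis because the first step of a cycle and the later ones use
    different estimates. *)
Lemma fista_next x r r' s e t st k :
  face_ball (1 / 14) x -> r <= 1 -> fista_state x r s e t st ->
  fista A S 24 (pst + x) k = st ->
  (forall kk, 1 / 8 <= kk <= 33 / 256 ->
    forall d, e ^+ 2 <= d ^+ 2 -> s ^+ 2 + 8 * d ^+ 2 <= r ->
    ((1 - kk) * (s + e)) ^+ 2 + 8 * ((1 - kk) * (s + e) - s) ^+ 2 <= r') ->
  r' <= 1 ->
  exists s' e' t', fista_state x r' s' e' t' (fista A S 24 (pst + x) k.+1).
Proof.
move=> bx r1 fs fE energy r'1; have [_ se] := fista_state_le r1 fs.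
have [tz uz] := fista_line bx se; have dz := dot_ge0 ((s + e) *: x).
have [est t1 [d ed sd]] := fs.
rewrite /= fE est /= grad_h_face //; last lra.
set z := (s + e) *: x in tz uz dz *; set u := 1 - _.
have u0 : u != 0 by rewrite /u; apply/eqP; lra.
(* A gradient step of length [1/24] along [(3 / u) z] rescales the position by [1 - kk];
   [u >= 32/33] gives the upper bound on [kk]. *)
pose kk := 1 / (8 * u).
have u_pos : 0 < 8 * u by rewrite /u; lra.
have kkb : 1 / 8 <= kk <= 33 / 256.
  rewrite /kk ler_pdivlMr // ler_pdivrMr //; apply/andP; split; rewrite /u; lra.
have -> : pst + z - 24^-1 *: ((3 / u) *: z) = pst + ((1 - kk) * (s + e)) *: x.
  apply/rowP => i; rewrite !mxE /kk; by field.
have En := energy kk kkb d ed sd.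
set s' := (1 - kk) * (s + e) in En *.
have s'1 : `|s'| <= 1.
  by apply: ler_norm_sqr => //; rewrite expr1n; have := sqr_ge0 (s' - s); lra.
have inQ : face_simplex S (pst + s' *: x).
  have [tx bnd] := bx.
  have [sQ _] : regular (pst + s' *: x).
    apply: face_regular; split; first exact: face_tangentZ.
    move=> i; rewrite mxE normrM; apply: le_trans (bnd i).
    by rewrite ler_piMl.
  split=> //; apply/supportedE.
  by have /face_tangentE[x1 _] := tx; rewrite !mxE /= x1 mulr0 addr0.
(* Since [|s'| <= 1], the gradient step has not left the face simplex, and the projection is
   trivial. *)
rewrite euclid_proj_id //.
set t' := (1 + _) / 2.
(* This puts the momentum coefficient [(t - 1) / t'] in [[0, 1]]. *)
have t't : t <= t'.
  have : 2 * t <= Num.sqrt (1 + 4 * t ^+ 2).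
    rewrite -[leLHS]ger0_norm; last lra.
    by rewrite -sqrtr_sqr ler_sqrt; nra.
  by rewrite /t'; lra.
exists s', ((t - 1) / t' * (s' - s)), t'; split; last 2 first.
- lra.
- exists (s' - s) => //; rewrite exprMn ler_piMl ?sqr_ge0 // expr_le1 //.
    by rewrite ler_pdivrMr; lra.
  by rewrite divr_ge0; lra.
- congr (_, _, _); apply/rowP => i; rewrite !mxE; ring.
Qed.

Lemma fista_state0 x : fista_state x 1 1 0 1 (fista A S 24 (pst + x) 0).
Proof.
split=> //; first by rewrite addr0 scale1r.
by exists 0; rewrite // expr1n expr0n mulr0 addr0.
Qed.

Lemma fista_contract x k : face_ball (1 / 14) x ->
  exists s e t, fista_state x ((19 / 20) ^+ 2) s e t (fista A S 24 (pst + x) k.+1).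
Proof.
have r1 : (19 / 20) ^+ 2 <= 1 :> R by rewrite expr2; lra.
move=> bx; elim: k => [|k [s [e [t fs]]]].
  apply: (fista_next bx (lexx 1) (fista_state0 x) erefl) => // kk /andP[k1 k2] _ _ _.
  (* From [s = 1], [e = 0] the new energy is [1 - 2 kk + 9 kk^2], below [(19/20)^2]. *)
  by rewrite addr0 mulr1; nra.
apply: (fista_next bx r1 fs erefl) => // kk kkb d ed; apply: le_trans.
exact: fista_energy.
Qed.

(** Extrapolated points are not known to stay in the ball of [face_regular], so positivity is
    checked on [m00] and [detA] directly. *)
Lemma fista_valid x k : face_ball (1 / 14) x ->
  queryable A (fista_y A pst (pst + x) k).
Proof.
move=> bx; have bound s e t r : r <= 1 ->
    fista_state x r s e t (fista A S 24 (pst + x) k) -> queryable A (fista_y A pst (pst + x) k).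
  move=> r1 fs; have [_ se] := fista_state_le r1 fs.
  have [tz uz] := fista_line bx se; have [est _ _] := fs.
  rewrite /fista_y L_loc_popt est /=; apply: queryableP; last by rewrite detA_face //; lra.
  have /face_tangentE[z1 sz] := tz; have [_ /(_ r0) x0] := bx.
  rewrite /m00; move: uz; rewrite dot_face // => uz.
  move: (sqr_ge0 (((s + e) *: x) 0 r2)) (sqr_ge0 (((s + e) *: x) 0 r3)) sz uz.
  rewrite [(pst + _) 0 r0]mxE [(pst + _) 0 r2]mxE [(pst + _) 0 r3]mxE !poptE.
  set a := (_ *: x) 0 r0; set b := (_ *: x) 0 r2; set c := (_ *: x) 0 r3.
  by move=> b2 c2 sz uz; nra.
case: k bound => [|k] bound; first exact: (bound _ _ _ _ (lexx 1) (fista_state0 x)).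
have [s [e [t fs]]] := fista_contract k bx; apply: bound fs; rewrite expr2; lra.
Qed.

Lemma fista_cycle b x : face_ball b x -> b <= 1 / 14 ->
  cycle_valid A pst (pst + x) /\
  exists2 x', fista_x A pst (pst + x) (cycle_length A pst) = pst + x' &
    face_ball (19 / 20 * b) x'.
Proof.
move=> bx b14; have bx14 := face_ball_le b14 bx; have [tx le_x] := bx.
(* A cycle has 11 steps, since [sqrt (8 * 18) = 12]. *)
have [s [e [t fs]]] := fista_contract 10 bx14.
have [est _ [d _ sd]] := fs.
have s_le : `|s| <= 19 / 20.
  by apply: ler_norm_sqr; [lra | have := sqr_ge0 d; lra].
have bx' : face_ball (19 / 20 * b) (s *: x).
  split; first exact: face_tangentZ.
  by move=> i; rewrite mxE normrM ler_pM.
have xE : fista_x A pst (pst + x) (cycle_length A pst) = pst + s *: x.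
  by rewrite cycle_length_popt /fista_x L_loc_popt est.
split; last by exists (s *: x).
split=> [k _|]; first exact: fista_valid.
have b0 := face_ball_ge0 bx; have b'14 : 19 / 20 * b <= 1 / 14 by lra.
have [] : regular (pst + s *: x) by exact: face_regular (face_ball_le b'14 bx').
by rewrite xE; exact: simplex_queryable.
Qed.

(** Each cycle costs [11 + 1] queries. The exponent is [k.+1] because a full cycle precedes the
    first test. *)
Lemma fista_returns_log eps k b x :
  face_ball b x -> b <= 1 / 14 -> 4 * ((19 / 20) ^+ k.+1 * b) <= eps * 2 ->
  exists m y, [/\ fista_returns A pst eps (pst + x) m y, john_ellipsoid A eps y &
    (m <= 12 * k.+1)%N].
Proof.
elim: k b x => [|k IH] b x bx b14 small;
  have [valid [x' xE bx']] := fista_cycle bx b14; have b0 := face_ball_ge0 bx;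
  have b'14 : 19 / 20 * b <= 1 / 14 by [lra];
  have reg' := face_regular (face_ball_le b'14 bx');
  have [gap_le|gap_gt] := leP (gap A (pst + x')) (eps * 2%:R);
  try (exists 12%N, (pst + x'); split; [ | exact: john_of_gap | exact: leq_pmulr];
       by rewrite -xE -[12%N]/(11.+1) -(@cycle_length_popt R); apply: Fista_stop; rewrite ?xE).
  by have := face_gap bx' b'14; move: small; rewrite expr1; lra.
have [|m [y [ret john le_m]]] := IH _ _ bx' b'14; first by rewrite [_ ^+ _ * (_ * b)]mulrA -exprSr.
exists (12 + m)%N, y; split=> //; last by rewrite mulnS leq_add2l.
rewrite -[12%N]/(11.+1) -(@cycle_length_popt R); apply: Fista_restart; rewrite ?xE //.
Qed.

End Fista.

(** * Facial Newton iteration *)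

Section Newton.
Context {R : realType}.
Implicit Types (p q x y z u : 'rV[R]_4) (i j : 'I_4) (b : R).

Local Notation A := (Astar R).
Local Notation pst := (@popt R).
Local Notation S := (Sstar A pst).

Lemma half_shiftE p j : half_shift p j = (1 - 2^-1) *: p + 2^-1 *: basis_vec j.
Proof. by rewrite /half_shift scalerDr; congr (_ *: _ + _); field. Qed.

Lemma detA_half_shift p j : detA p != 0 ->
  detA (half_shift p j) = detA p * (1 + lev A p 0 j) / 4.
Proof. by move=> D0; rewrite half_shiftE detA_move //; field. Qed.

Lemma half_shift_regular p j : regular p -> regular (half_shift p j).
Proof.
move=> reg_p; have [sp Dp] := reg_p; have [pge0 _] := sp; split; last first.
  rewrite detA_half_shift ?gt_eqF // divr_gt0 // mulr_gt0 //.
  by have := lev_ge0 j reg_p; lra.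
rewrite half_shiftE; apply: simplex_move => //; first lra.
by have := pge0 j; lra.
Qed.

(** Both sides are [v_i (p + e_j)]: adding [e_j] turns the [i]-th partial derivative of [detA] into
    [grad_det p i + wedge2 i j], and [detA p] into [detA p * (1 + v_j)]. *)
Lemma lev_half_shift p i j : regular p ->
  lev A (half_shift p j) 0 i / 2 =
    (lev A p 0 i + wedge2 i j / detA p) / (1 + lev A p 0 j).
Proof.
move=> reg_p; have [_ Dp] := reg_p; have D0 : detA p != 0 by rewrite gt_eqF.
have v0 : 1 + lev A p 0 j != 0 by have := lev_ge0 j reg_p => ?; apply/eqP; lra.
have [_ Dh] := half_shift_regular j reg_p; have Dh0 : detA (half_shift p j) != 0 by rewrite gt_eqF.
have := lev_grad i Dh0; rewrite detA_half_shift //.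
have -> : grad_det (half_shift p j) i = (grad_det p i + wedge2 i j) / 2.
  have -> : half_shift p j = 2^-1 *: (1 *: basis_vec j + p).
    by rewrite /half_shift scale1r addrC.
  have gZ (a : R) x : grad_det (a *: x) i = a * grad_det x i.
    by rewrite /grad_det !mxE; ring.
  have -> : wedge2 i j = wedge2 j i :> R by rewrite /wedge2; ring.
  by rewrite gZ grad_det_line mul1r mulrC.
rewrite lev_grad // => e.
apply: (mulIf (_ : detA p * (1 + lev A p 0 j) / 2 != 0)).
  by rewrite !mulf_neq0 // invr_neq0.
transitivity ((lev A p 0 i * detA p + wedge2 i j) / 2); last by field; rewrite D0 v0.
by rewrite e; field.
Qed.

Lemma queried_HhatE p i j : regular p -> i \in S -> j \in S ->
  queried_Hhat A pst p i j =
    lev A p 0 i * lev A p 0 j - (if i == j then 0 else 4) / detA p.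
Proof.
move=> reg_p iS jS; have [_ Dp] := reg_p; rewrite mxE iS jS /= lev_half_shift //.
have D0 : detA p != 0 by rewrite gt_eqF.
have v0 : 1 + lev A p 0 j != 0 by have := lev_ge0 j reg_p => ?; apply/eqP; lra.
have -> : (if i == j then 0 else 4) = wedge2 i j :> R.
  have [[a0 a1 a2 a3] [b0 b1 b2 b3] [c0 c1 c2 c3] [d0 d1 d2 d3]] := @wedge2E R.
  move: iS jS; rewrite !SstarE {v0}.
  by move: i j; apply: forall_ord4; apply: forall_ord4 => //=;
    rewrite ?a0 ?a1 ?a2 ?a3 ?c0 ?c1 ?c2 ?c3 ?d0 ?d1 ?d2 ?d3.
by field; rewrite D0 v0.
Qed.

(** On the face all off-diagonal minors squared equal 4, so the queried matrix is
    [v v^T - (4 / detA p) (J - I)] with [J] all ones, and [J] annihilates sum-zero vectors. *)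
Lemma newton_row p u i : regular p -> face_tangent S u -> i \in S ->
  \sum_j queried_Hhat A pst p i j * u 0 j =
    lev A p 0 i * dot (lev A p) u + 4 / detA p * u 0 i.
Proof.
move=> reg_p /face_tangentE[u1 su] iS; rewrite dot4 sum_ord4 u1 !mulr0 !addr0.
rewrite !(queried_HhatE reg_p iS) ?SstarE //.
have u3 : u 0 r3 = - u 0 r0 - u 0 r2 by lra.
by move: iS; rewrite SstarE; move: i; apply: forall_ord4 => //= _; rewrite u3; ring.
Qed.

(* The leverage scores are [(2 - 3 x_i) / (1 - t)] with [t = 3/2 |x|^2], so the
   Newton step is radial. *)
Lemma newton_step x : face_ball (1 / 14) x ->
  let q := 3 * dot x x / (1 - 3 / 2 * dot x x) in
  unique (newton_system A pst (pst + x)) (- (1 + q)^-1 *: x) /\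
  dot (lev A (pst + x)) (- (1 + q)^-1 *: x) = q / (1 + q).
Proof.
move=> bx q; have reg_p := face_regular bx; have [_ Dp] := reg_p.
have := face_ball_dot bx; have [tx _] := bx => dx.
have dx0 := dot_ge0 x; have u1 : 3 / 2 * dot x x < 1 by lra.
have t0 : 1 - 3 / 2 * dot x x != 0 by apply/eqP; lra.
have q0 : 0 <= q by rewrite /q divr_ge0; lra.
have q1 : 1 + q != 0 by apply/eqP; lra.
have levx i := @lev_face_in _ x i tx u1.
have tn := face_tangentZ (- (1 + q)^-1) tx.
have /face_tangentE[x1 sx] := tx.
have vx : dot (lev A (pst + x)) x = - q.
  rewrite dot4 x1 mulr0 addr0 !levx ?SstarE // /q; move: t0; set T := 1 - _ => t0.
  have x3 : x 0 r3 = - x 0 r0 - x 0 r2 by lra.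
  by rewrite dot_face // x3; field.
have dotZr (v y : 'rV[R]_4) (a : R) : dot v (a *: y) = a * dot v y.
  by rewrite !dot4 !mxE; ring.
have wE : dot (lev A (pst + x)) (- (1 + q)^-1 *: x) = q / (1 + q).
  by rewrite dotZr vx mulrNN mulrC.
split=> //; split.
  split=> //; exists (2 / (1 - 3 / 2 * dot x x) / (1 + q)) => i iS.
  rewrite newton_row // wE levx // detA_face // mxE.
  move: t0 q1; set T := 1 - _ => t0; set Q := 1 + q => q1.
  have -> : q = Q - 1 by rewrite /Q; ring.
  by field; rewrite t0 q1.
move=> y [ty [nu sol]]; have /face_tangentE[y1 sy] := ty.
pose W := dot (lev A (pst + x)) y.
have row i : i \in S -> (2 - 3 * x 0 i) * (W - 1) + 3 * y 0 i = - nu * (1 - 3 / 2 * dot x x).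
  move=> iS; have := sol i iS; rewrite newton_row // levx // -/W detA_face //.
  move: t0; set T := 1 - _ => t0 e.
  have -> : - nu = (2 - 3 * x 0 i) / T * W + 4 / (4 / 3 * T) * y 0 i - (2 - 3 * x 0 i) / T.
    by rewrite -[X in _ = _ - X]e; ring.
  by field.
have := row r0; have := row r2; have := row r3; rewrite !SstarE.
move=> /(_ isT) e3 /(_ isT) e2 /(_ isT) e0.
(* Adding the three rows eliminates [nu] and leaves [y = (W - 1) x]; pairing with the scores then
   determines [W]. *)
have sxW : (x 0 r0 + x 0 r2 + x 0 r3) * (W - 1) = 0 by rewrite sx mul0r.
have yE : y = (W - 1) *: x.
  by apply/rowP; apply: forall_ord4; rewrite !mxE ?x1 ?y1; lra.
have : W = (W - 1) * - q by rewrite -vx -dotZr -yE.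
move=> We; rewrite [RHS]yE; congr (_ *: _).
apply: (mulIf q1); rewrite mulNr mulVf //; lra.
Qed.

(** As [lambda^2 = q / (1 + q) <= 1/16], the full step is taken; it rescales [x] by [q / (1 + q)],
    at most [b] because [q <= 10 b^2] and [b <= 1/14]. *)
Lemma newton_contract b x : face_ball b x -> b <= 1 / 14 ->
  exists2 u, unique (newton_system A pst (pst + x)) u &
    exists2 x', newton_update A pst (pst + x) u = pst + x' & face_ball (b ^+ 2) x'.
Proof.
move=> bx b14; have dx := face_ball_dot bx; have [tx le_x] := bx.
have b0 := face_ball_ge0 bx.
have [] := newton_step (face_ball_le b14 bx); set q := 3 * _ / _ => un wE.
exists (- (1 + q)^-1 *: x) => //.
have b2 : b ^+ 2 <= b / 14 by rewrite expr2; nra.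
have dx0 := dot_ge0 x.
have u_gt0 : 0 < 1 - 3 / 2 * dot x x by lra.
have q0 : 0 <= q by rewrite /q divr_ge0 //; lra.
have q_le : q <= 10 * b ^+ 2 by rewrite /q ler_pdivrMr //; nra.
exists ((q / (1 + q)) *: x); last first.
  split; first exact: face_tangentZ.
  move=> i; rewrite mxE normrM ger0_norm; last by rewrite divr_ge0 //; lra.
  rewrite expr2; apply: ler_pM => //; first by rewrite divr_ge0 //; lra.
  by rewrite ler_pdivrMr; nra.
rewrite /newton_update.
have -> : \sum_(i in S) lev A (pst + x) 0 i * (- (1 + q)^-1 *: x) 0 i = q / (1 + q).
  rewrite -wE dotE [RHS](bigID (mem S)) /= [X in _ = _ + X]big1 ?addr0 // => i iS.
  by have [sx _] := tx; rewrite [(_ *: x) 0 i]mxE sx // !mulr0.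
have lam : Num.sqrt (q / (1 + q)) <= 1 / 4.
  have -> : 1 / 4 = Num.sqrt ((1 / 4) ^+ 2) :> R by rewrite sqrtr_sqr ger0_norm //; lra.
  by apply: ler_wsqrtr; rewrite ler_pdivrMr; rewrite ?expr2; lra.
rewrite ltNge lam /= -addrA; congr (_ + _); apply/rowP => i; rewrite !mxE.
have q1 : 1 + q != 0 by apply/eqP; lra.
by field.
Qed.

(** At most [k] updates bring the bound to [b^(2^k)]; the extra iteration is the one whose test
    succeeds. *)
Lemma newton_returns_loglog eps k b x :
  face_ball b x -> b <= 1 / 14 -> 4 * b ^+ (2 ^ k) <= eps * 2 ->
  exists m y, [/\ newton_returns A pst eps (pst + x) m y, john_ellipsoid A eps y &
    (m <= k.+1)%N].
Proof.
elim: k b x => [|k IH] b x bx b14 small;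
  have reg_p := face_regular (face_ball_le b14 bx);
  have qry : queryable A (pst + x) by [have [sp Dp] := reg_p; exact: simplex_queryable];
  have [gap_le|gap_gt] := leP (gap A (pst + x)) (eps * 2%:R);
  try (exists 1%N, (pst + x); split=> //; [exact: Newton_stop | exact: john_of_gap]).
  by have := face_gap bx b14; move: small; rewrite expn0 expr1; lra.
have [u un [x' xE bx']] := newton_contract bx b14.
have b0 := face_ball_ge0 bx.
have b2 : b ^+ 2 <= 1 / 14 by rewrite expr2; nra.
have [|m [y [ret john le_m]]] := IH _ _ bx' b2; first by rewrite -exprM -expnS.
exists m.+1, y; split=> //; apply: (Newton_iter (u := u)) => //; last by rewrite xE.
move=> j _; have [sj Dj] := half_shift_regular j reg_p; exact: simplex_queryable.
Qed.

End Newton.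

(** * Uniform averages *)

Section Averages.
Context {R : realType}.
Implicit Types (p q x y z : 'rV[R]_4) (i j : 'I_4).

Local Notation A := (Astar R).

Definition interior_simplex p := simplex p /\ forall i, 0 < p 0 i.

Lemma interior_regular p : interior_simplex p -> regular p.
Proof.
move=> [sp p_gt0]; split=> //.
apply: lt_le_trans (detA_ge_pair sp (_ : r0 != r1)) => //.
exact: mulr_gt0.
Qed.

Lemma mult_iter_interior t : interior_simplex (mult_iter A t).
Proof.
elim: t => [|t IH].
  split=> [|i]; last by rewrite mxE invr_gt0 ltr0n.
  by apply/simplexE; rewrite !mxE; split; lra.
have [sp Dp] := interior_regular IH; have [_ p_gt0] := IH.
have [e0 e1 e2 e3] := levE (lt0r_neq0 Dp); have sum2 := sum_p_lev (lt0r_neq0 Dp).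
have v_gt0 i : 0 < lev A (mult_iter A t) 0 i.
  have := p_gt0 r0; have := p_gt0 r1; have := p_gt0 r2; have := p_gt0 r3.
  by move: i; apply: forall_ord4; rewrite ?e0 ?e1 ?e2 ?e3 => *; rewrite divr_gt0 //; lra.
have next_gt0 i : 0 < mult_iter A t.+1 0 i.
  by rewrite /= mxE divr_gt0 ?mulr_gt0 // ltr0n.
split=> //; apply/simplexE; split; rewrite ?(ltW (next_gt0 _)) //.
have mE i : mult_iter A t.+1 0 i = mult_iter A t 0 i * lev A (mult_iter A t) 0 i / 2%:R.
  by rewrite /= mxE.
by rewrite !mE -!mulrDl sum2 divff.
Qed.

Lemma prod_lev_mult_iter i T :
  (\prod_(t < T) lev A (mult_iter A t) 0 i) * mult_iter A 0 0 i = 2 ^+ T * mult_iter A T 0 i.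
Proof.
elim: T => [|T IH]; first by rewrite big_ord0 expr0.
rewrite big_ord_recr /= mulrAC IH [in RHS]mxE exprS; by field.
Qed.

Lemma uniform_avgE T i :
  uniform_avg A T 0 i = T%:R^-1 * \sum_(t < T) mult_iter A t 0 i.
Proof. by rewrite /uniform_avg mxE summxE. Qed.

Lemma uniform_avg_interior T : (0 < T)%N -> interior_simplex (uniform_avg A T).
Proof.
move=> T0; have TR : 0 < T%:R :> R by rewrite ltr0n.
have avg_gt0 i : 0 < uniform_avg A T 0 i.
  rewrite uniform_avgE mulr_gt0 ?invr_gt0 //.
  case: T T0 {TR} => // T _; rewrite big_ord_recl ltr_pwDl //.
    by have [_ ->] := mult_iter_interior 0.
  by apply: sumr_ge0 => t _; apply/ltW; have [_ ->] := mult_iter_interior (lift ord0 t).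
split=> //; split=> [i|]; first exact/ltW.
under eq_bigr do rewrite uniform_avgE.
rewrite -mulr_sumr exchange_big /= (eq_bigr (fun=> 1)) => [|t _].
  by rewrite sumr_const card_ord mulVf // gt_eqF.
by have [[_ ->] _] := mult_iter_interior t.
Qed.

(** The first iterate alone contributes [1/4] to the sum. *)
Lemma uniform_avg_r1 T : (0 < T)%N -> (4 * T%:R)^-1 <= uniform_avg A T 0 r1.
Proof.
case: T => // T _; rewrite uniform_avgE invfM mulrC ler_pM2l ?invr_gt0 ?ltr0n //.
rewrite big_ord_recl mxE lerDl sumr_ge0 // => t _.
by apply/ltW; have [_ ->] := mult_iter_interior (lift ord0 t).
Qed.

(** The [p]-weighted mean of the scores is 2, so [2 <= (1 - p_1) (2 + 2 eps) + 7/4 p_1] and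
    [p_1 <= 8 eps], against [p_1 >= 1 / (4 T)]. The bound [1/144] makes [2 eps] an admissible
    tolerance for [lev_r1_small]. *)
Lemma gap_avg_lower T (eps : R) : (0 < T)%N -> eps <= 1 / 144 ->
  gap A (uniform_avg A T) <= eps * 2 -> 1 / 32 * eps^-1 <= T%:R.
Proof.
move=> T0 eps144; set p := uniform_avg A T; rewrite /gap lerBlDr.
move=> /(max_over_le _ _ (ex_intro _ r0 isT)).1 le_v.
have [sp p_gt0] := uniform_avg_interior T0.
have reg_p := interior_regular (uniform_avg_interior T0).
rewrite -/p in sp p_gt0 reg_p *; have [_ Dp] := reg_p.
have sum2 := sum_p_lev (lt0r_neq0 Dp); have [_ _ _ _ s1] := (simplexE _).1 sp.
have v0 := ler_wpM2l (ltW (p_gt0 r0)) (le_v r0 isT).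
have v1' := ler_wpM2l (ltW (p_gt0 r1)) (le_v r1 isT).
have v2 := ler_wpM2l (ltW (p_gt0 r2)) (le_v r2 isT).
have v3 := ler_wpM2l (ltW (p_gt0 r3)) (le_v r3 isT).
have eps2 : 0 <= eps * 2.
  suff : 2 <= (p 0 r0 + p 0 r1 + p 0 r2 + p 0 r3) * (eps * 2 + 2) by rewrite s1; lra.
  by rewrite !mulrDl; lra.
have small : lev A p 0 r1 < 7 / 4.
  apply: (lev_r1_small (c := eps * 2)) => //; first lra.
  by move=> i; rewrite addrC; exact: le_v.
have v1 := ler_wpM2l (ltW (p_gt0 r1)) (ltW small).
have p1_le : p 0 r1 / 4 <= eps * 2.
  suff : 2 <= (p 0 r0 + p 0 r2 + p 0 r3) * (eps * 2 + 2) + p 0 r1 * (7 / 4).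
    have -> : p 0 r0 + p 0 r2 + p 0 r3 = 1 - p 0 r1 by lra.
    by have := mulr_ge0 (ltW (p_gt0 r1)) eps2; lra.
  by rewrite !mulrDl; lra.
have := uniform_avg_r1 T0; rewrite -/p => p1_ge.
have TR : 0 < T%:R :> R by rewrite ltr0n.
have : (4 * T%:R)^-1 <= 8 * eps by lra.
have eps0 : 0 < eps.
  by have : 0 < (4 * T%:R)^-1 :> R by [rewrite invr_gt0 mulr_gt0]; lra.
rewrite -[(4 * T%:R)^-1]div1r ler_pdivrMr ?mulr_gt0 // ler_pdivrMr //; lra.
Qed.

Definition infoq p (X Y : R) := m00 p * X ^+ 2 + 2 * m01 p * (X * Y) + m11 p * Y ^+ 2.

(** Cauchy-Schwarz [(a . z)^2 <= (a^T M^-1 a) (z^T M z)] at [z = (X, Y)]; in dimension 2 the defect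
    times [detA p] is a single square. *)
Lemma lev_cauchy p i (X Y : R) : regular p ->
  (A i 0 * X + A i 1 * Y) ^+ 2 <= lev A p 0 i * infoq p X Y.
Proof.
move=> [_ Dp]; rewrite [lev A p 0 i]mxE cross_levE ?gt_eqF // mulrAC ler_pdivlMr // -subr_ge0.
have -> : crossN p i i * infoq p X Y - (A i 0 * X + A i 1 * Y) ^+ 2 * detA p =
  (A i 0 * (m01 p * X + m11 p * Y) - A i 1 * (m00 p * X + m01 p * Y)) ^+ 2.
  by rewrite /crossN /infoq /detA; ring.
exact: sqr_ge0.
Qed.

Lemma infoq_avg T (X Y : R) : (0 < T)%N ->
  (\sum_(t < T) infoq (mult_iter A t) X Y) / T%:R = infoq (uniform_avg A T) X Y.
Proof.
move=> T0; rewrite /infoq /m00 /m01 /m11 !uniform_avgE.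
rewrite !big_split /= -!mulr_suml -!mulr_sumr !sumrB !big_split /= -!mulr_sumr; ring.
Qed.

Lemma infoq_ge0 p X Y : regular p -> 0 <= infoq p X Y.
Proof.
move=> reg_p; have [sp _] := reg_p; have [p0 p1 p2 p3 _] := (simplexE _).1 sp.
have -> : infoq p X Y = p 0 r0 * (4 * X ^+ 2) + p 0 r1 * Y ^+ 2
   + p 0 r2 * (X + Y) ^+ 2 + p 0 r3 * (X - Y) ^+ 2.
  by rewrite /infoq /m00 /m01 /m11; ring.
have sq (x : R) : 0 <= x ^+ 2 by exact: sqr_ge0.
have h0 := mulr_ge0 p0 (sq X); have h1 := mulr_ge0 p1 (sq Y).
have h2 := mulr_ge0 p2 (sq (X + Y)); have h3 := mulr_ge0 p3 (sq (X - Y)); lra.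
Qed.

(* Log-convexity of [v_i]: Cauchy-Schwarz at [z = adj M(avg) a_i] bounds each
   [v_i(p_t)] below by [(a_i . z)^2 / (z^T M(p_t) z)], whose denominator is linear
   in [p_t], so that AM-GM bounds the product of the denominators. *)
Lemma lev_avg_pow T i : (0 < T)%N ->
  lev A (uniform_avg A T) 0 i ^+ T <= \prod_(t < T) lev A (mult_iter A t) 0 i.
Proof.
move=> T0; set p := uniform_avg A T.
have reg_p : regular p := interior_regular (uniform_avg_interior T0).
have [_ Dp] := reg_p; have reg_t t := interior_regular (mult_iter_interior t).
pose X := m11 p * A i 0 - m01 p * A i 1; pose Y := m00 p * A i 1 - m01 p * A i 0.
pose N := crossN p i i.
have aXY : A i 0 * X + A i 1 * Y = N by rewrite /N /crossN /X /Y; ring.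
have qXY : infoq p X Y = N * detA p by rewrite /N /crossN /X /Y /infoq /detA; ring.
have levN : lev A p 0 i = N / detA p by rewrite mxE cross_levE // gt_eqF.
have [N_gt0|N_le0] := ltP 0 N; last first.
  have -> : lev A p 0 i = 0.
    apply/le_anti; rewrite lev_ge0 // andbT.
    by rewrite levN mulr_le0_ge0 // invr_ge0 ltW.
  by rewrite expr0n gtn_eqF //; apply: prodr_ge0 => t _; exact: lev_ge0.
have agm : \prod_(t < T) infoq (mult_iter A t) X Y <= (N * detA p) ^+ T.
  have := leif_AGM (A := 'I_T) (E := fun t : 'I_T => infoq (mult_iter A t) X Y).
  case=> [t _|]; first exact: infoq_ge0.
  by rewrite card_ord infoq_avg // -/p qXY.
have cs : (N ^+ 2) ^+ T <= (\prod_(t < T) lev A (mult_iter A t) 0 i) *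
    \prod_(t < T) infoq (mult_iter A t) X Y.
  rewrite -big_split /= -[X in _ ^+ X]card_ord -prodr_const; apply: ler_prod => t _.
  by rewrite sqr_ge0 -aXY; exact: lev_cauchy.
have P0 : 0 <= \prod_(t < T) lev A (mult_iter A t) 0 i.
  by apply: prodr_ge0 => t _; exact: lev_ge0.
have := le_trans cs (ler_wpM2l P0 agm).
have ND_gt0 : 0 < (N * detA p) ^+ T by rewrite exprn_gt0 // mulr_gt0.
rewrite -ler_pdivrMr // -expr_div_n; congr (_ <= _); congr (_ ^+ _).
by rewrite levN; field; rewrite !gt_eqF.
Qed.

(** Telescoping gives [v^T <= 4 * 2^T], the 4 being the inverse of the initial weight. Bernoulli
    applied to [(v / 2)^T <= 4] then yields [T (v - 2) / 2 <= 3]. *)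
Lemma gap_avg_upper T : (0 < T)%N -> gap A (uniform_avg A T) <= 6 / T%:R.
Proof.
move=> T0; have TR : 0 < T%:R :> R by rewrite ltr0n.
rewrite /gap lerBlDr; apply/max_over_le => [|i _]; first by exists r0.
set v := lev _ _ _ _; rewrite -lerBlDr leNgt; apply/negP => g_gt.
have g0 : 0 < v - 2 by apply: le_lt_trans g_gt; rewrite divr_ge0 // ltW.
have m0 : mult_iter A 0 0 i = 4^-1 :> R by rewrite mxE.
have [sT _] := mult_iter_interior T.
have pow_le : v ^+ T <= 2 ^+ T * 4.
  apply: le_trans (lev_avg_pow i T0) _.
  have -> : \prod_(t < T) lev A (mult_iter A t) 0 i = 2 ^+ T * mult_iter A T 0 i * 4.
    by rewrite -prod_lev_mult_iter m0; field.
  by rewrite ler_wpM2r // ler_piMr ?exprn_ge0 // simplex_le1.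
have := bernoulli T (_ : 0 <= (v - 2) / 2).
have -> : 1 + (v - 2) / 2 = v / 2 by field.
rewrite expr_div_n => /(_ (divr_ge0 (ltW g0) _)) H.
have : v ^+ T / 2 ^+ T <= 4 by rewrite ler_pdivrMr ?exprn_gt0 // mulrC.
move: g_gt; rewrite ltr_pdivrMr // => g_gt.
have := H (ler0n _ _); lra.
Qed.

End Averages.

(** * Convergence rates *)

Section Rates.
Context {R : realType}.
Implicit Types (eps : R).

Local Notation A := (Astar R).
Local Notation pst := (@popt R).

Lemma expRN_ln_inv eps : 0 < eps -> expR (- ln (1 / eps)) = eps.
Proof. by move=> e0; rewrite div1r lnV ?posrE // opprK lnK ?posrE. Qed.

Lemma ln_inv_ge eps (x : R) : 0 < eps -> eps < expR (- x) -> x <= ln (1 / eps).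
Proof.
by move=> e0 lt_eps; rewrite -lerN2 -ler_expR expRN_ln_inv // ltW.
Qed.

Lemma nat_floor (x : R) : 0 <= x -> exists k : nat, k%:R <= x < k%:R + 1.
Proof.
move=> x0; exists (Num.truncn x).
by rewrite truncn_le x0 natr1 truncnS_gt.
Qed.

Lemma fista_phase x eps : face_ball (1 / 14) x -> 0 < eps < expR (- 1) ->
  exists m y, [/\ fista_returns A pst eps (pst + x) m y, john_ellipsoid A eps y &
    m%:R <= 12 * 21 * ln (1 / eps)].
Proof.
move=> bx /andP[eps0 eps1]; have L1 := ln_inv_ge eps0 eps1.
set L := ln (1 / eps) in L1 *.
(* With [19/20 <= exp (-1/20)], [k.+1 > 20 L] cycles suffice, and [L >= 1] absorbs the rounding into
   the factor 21. *)
have [|k /andP[k_le k_gt]] := @nat_floor (20 * L); first lra.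
have small : (19 / 20) ^+ k.+1 <= eps :> R.
  have e0 := expR_ge0 (- (1 / 20) : R).
  apply: (@le_trans _ _ (expR (- (1 / 20)) ^+ k.+1)).
    apply: lerXn2r; [rewrite nnegrE; lra | by rewrite nnegrE |].
    by apply: le_trans (expR_ge1Dx _); lra.
  rewrite -expRM_natr -(expRN_ln_inv eps0) ler_expR -/L.
  by rewrite -[k.+1%:R]natr1; lra.
have [|m [y [ret john le_m]]] := fista_returns_log (eps := eps) (k := k) bx (lexx _).
  by move: small; set X := _ ^+ _; lra.
exists m, y; split=> //.
apply: (@le_trans _ _ (12 * k.+1)%:R); first by rewrite ler_nat.
by rewrite natrM -[k.+1%:R]natr1; lra.
Qed.

(** The factor [1/2] absorbs the ratio between the gap bound [4 b] and the target [2 eps]. *)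
Lemma pow14_le n : (0 < n)%N -> (1 / 14) ^+ n <= 1 / 2 * expR (- n%:R) :> R.
Proof.
have e1 : 1 / 7 <= expR (- 1) :> R.
  have half_le : 1 / 2 <= expR (- (1 / 2)) :> R by apply: le_trans (expR_ge1Dx _); lra.
  have -> : -1 = - (1 / 2) + - (1 / 2) :> R by field.
  by rewrite expRD; nra.
case: n => // n _; elim: n => [|n IH]; first by rewrite expr1; lra.
have -> : - n.+2%:R = - 1 + - n.+1%:R :> R by rewrite -natr1; ring.
rewrite exprS expRD (mulrCA (1 / 2)).
by apply: ler_pM; [lra | apply: exprn_ge0; lra | lra | exact: IH].
Qed.

Lemma newton_phase x eps : face_ball (1 / 14) x -> 0 < eps < expR (- expR 1) ->
  exists m y, [/\ newton_returns A pst eps (pst + x) m y, john_ellipsoid A eps y &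
    m%:R <= 4 * ln (ln (1 / eps))].
Proof.
move=> bx /andP[eps0 eps1]; have Le := ln_inv_ge eps0 eps1.
set L := ln (1 / eps) in Le *.
have L0 : 0 < L by apply: lt_le_trans Le; exact: expR_gt0.
have l1 : 1 <= ln L by rewrite -ler_expR lnK ?posrE.
(* Since [exp (1/2) <= 2], any [k > 2 ln L] satisfies [2^k >= L]. As [ln L >= 1], the total [k + 1]
   is at most [4 ln L]. *)
have [|k' /andP[k'_le k'_gt]] := @nat_floor (2 * ln L); first lra.
have [k k_gt k_le] : exists2 k : nat, 2 * ln L < k%:R :> R & k%:R <= 2 * ln L + 1 :> R.
  by exists k'.+1; rewrite -natr1; lra.
have half_le : 1 / 2 <= expR (- (1 / 2)) :> R by apply: le_trans (expR_ge1Dx _); lra.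
have L_le : L <= (2 ^ k)%:R.
  have -> : L = expR (ln L) by rewrite lnK ?posrE.
  apply: (@le_trans _ _ (expR (1 / 2) ^+ k)); first by rewrite -expRM_natr ler_expR; lra.
  rewrite natrX; apply: lerXn2r; [by rewrite nnegrE expR_ge0 | by rewrite nnegrE |].
  have := expRN (1 / 2 : R); have := expR_gt0 (1 / 2 : R) => e0 eN.
  by move: half_le; rewrite eN ler_pdivrMr // mulrC ler_pdivlMr //; lra.
have small : 4 * (1 / 14) ^+ (2 ^ k) <= eps * 2 :> R.
  have N_gt0 : (0 < 2 ^ k)%N by rewrite expn_gt0.
  have := pow14_le N_gt0; move: L_le; set N := (2 ^ k)%N => L_le N_le.
  have : expR (- N%:R) <= eps by rewrite -(expRN_ln_inv eps0) ler_expR lerN2.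
  by move: N_le; set X := _ ^+ N; set Y := expR _; lra.
have [m [y [ret john le_m]]] := newton_returns_loglog bx (lexx _) small.
exists m, y; split=> //; apply: (@le_trans _ _ k.+1%:R); first by rewrite ler_nat.
rewrite -natr1; lra.
Qed.

Lemma averaging_rate eps : 0 < eps < 1 / 144 ->
  (forall T : nat, (0 < T)%N -> gap A (uniform_avg A T) <= eps * 2 ->
     1 / 32 * eps^-1 <= T%:R) /\
  (exists T : nat, [/\ (0 < T)%N, gap A (uniform_avg A T) <= eps * 2 &
     T%:R <= 4 * eps^-1]).
Proof.
move=> /andP[eps0 eps1]; split=> [T T0|]; first exact: gap_avg_lower (ltW eps1).
have ie : 144 <= eps^-1 by rewrite -[144]invrK lef_pV2 ?posrE ?invr_gt0 //; lra.
(* [T > 3 / eps] is what [6 / T <= 2 eps] asks for. *)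
have [|k /andP[k_le k_gt]] := @nat_floor (3 * eps^-1); first lra.
exists k.+1; split=> //; last by rewrite -[k.+1%:R]natr1; lra.
apply: le_trans (gap_avg_upper (ltn0Sn _)) _; rewrite ler_pdivrMr ?ltr0n // -[k.+1%:R]natr1.
have : eps * (3 * eps^-1) <= eps * (k%:R + 1) by rewrite ler_pM2l // ltW.
by rewrite mulrCA mulfV ?gt_eqF //; lra.
Qed.

End Rates.

(* C0 is the absolute constant of the O(1) condition number: it precedes R, so
   that it cannot be chosen in terms of the matrix or of its condition number. *)
Theorem corollary5p9 :
  exists C0 : nat, forall R : realType,
  (exists! pstar, optimal_design (Astar R) pstar) /\
  forall pstar : 'rV[R]_4, optimal_design (Astar R) pstar ->
  (* nondegeneracy and conditioning *)
  (nondegenerate_design (Astar R) pstar /\ kappa (Astar R) pstar = 2) /\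
  (posdef_on sum_zero (hessian (fobj (Astar R)) pstar) /\
   0 < lambda_min sum_zero (hessian (fobj (Astar R)) pstar) /\
   lambda_max sum_zero (hessian (fobj (Astar R)) pstar) /
     lambda_min sum_zero (hessian (fobj (Astar R)) pstar) <= C0%:R) /\
  (* (1) *)
  (let gsc := gamma_sc (Astar R) pstar in
   let c := Num.min (c_0 (Astar R) pstar)
                    ((1 / 126) ^+ 2 / kappa (Astar R) pstar ^+ 3) in
   (exists p, loop_run (Astar R) gsc c p) /\
   exists C eps0 : R, 0 < eps0 /\
   forall eps : R, 0 < eps < eps0 ->
   forall p, loop_run (Astar R) gsc c p ->
   exists k m x,
     [/\ loop_exits (Astar R) gsc c p k,
         fista_returns (Astar R) pstar eps (p k) m x,
         john_ellipsoid (Astar R) eps x &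
         (k.+1 + m)%:R <= C * ln (1 / eps)]) /\
  (* (2) *)
  (let gsc := gamma_sc (Astar R) pstar in
   let c := c_0 (Astar R) pstar in
   (exists p, loop_run (Astar R) gsc c p) /\
   exists (K : nat) (C eps0 : R), 0 < eps0 /\
   forall eps : R, 0 < eps < eps0 ->
   forall p, loop_run (Astar R) gsc c p ->
   exists k m x,
     [/\ loop_exits (Astar R) gsc c p k /\ (k <= K)%N,
         newton_returns (Astar R) pstar eps (p k) m x,
         john_ellipsoid (Astar R) eps x &
         m%:R <= C * ln (ln (1 / eps))]) /\
  (* (3) *)
  ((forall t, queryable (Astar R) (mult_iter (Astar R) t)) /\
   exists C1 C2 eps0 : R, [/\ 0 < C1, 0 < C2, 0 < eps0 &
   forall eps : R, 0 < eps < eps0 ->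
     (forall T : nat, (0 < T)%N ->
        gap (Astar R) (uniform_avg (Astar R) T) <= eps * 2 ->
        C1 * eps^-1 <= T%:R) /\
     (exists T : nat,
        [/\ (0 < T)%N, gap (Astar R) (uniform_avg (Astar R) T) <= eps * 2 &
            T%:R <= C2 * eps^-1])]).
Proof.
(* [300] is the quotient of the bounds [15] and [1/20] of [hessian_bounds]. *)
exists 300%N => R; set A := Astar R.
split; first by exists popt; split=> [|q /optimal_uniq //]; exact: optimal_popt.
move=> _ /optimal_uniq ->; rewrite gamma_sc_popt kappa_popt.
have c0_gt0 := @c_0_popt_gt0 R; have c0_le := @c_0_popt_le R.
split; first by split=> //; exact: nondegenerate_popt.
split; first by have [] := @hessian_conditioning R.
split; [move=> gsc c | split; [move=> gsc c | split]].
- have c_gt0 : 0 < c.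
    by rewrite /c lt_min c0_gt0 /= divr_gt0 // exprn_gt0; lra.
  have c_le : c <= 1 / 72 by rewrite /c ge_min c0_le.
  split; first exact: loop_run_exists.
  have [K terminates] := loop_terminates c_gt0 c_le.
  (* The constant loop cost [K + 1] is absorbed because [eps < exp (-1)] makes [ln (1 / eps)] at
     least 1. *)
  exists (K%:R + 1 + 12 * 21), (expR (- 1)); split; first exact: expR_gt0.
  move=> eps eps_small p run; have [k [exits kK reg_k]] := terminates p run.
  have [_ ncond _] := exits.
  have [x px bx] := exit_face_ball reg_k (ltW c_gt0) c_le ncond.
  have [m [y [ret john le_m]]] := fista_phase bx eps_small.
  exists k, m, y; split=> //; first by rewrite px.
  have /andP[eps0 eps1] := eps_small; have L1 := ln_inv_ge eps0 eps1.
  have kKR : k%:R <= K%:R :> R by rewrite ler_nat.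
  have K0 : 0 <= K%:R :> R by exact: ler0n.
  rewrite natrD -natr1; have : K%:R <= K%:R * ln (1 / eps) by rewrite ler_peMr.
  lra.
- split; first exact: loop_run_exists.
  have [K terminates] := loop_terminates c0_gt0 c0_le.
  exists K, 4, (expR (- expR 1)); split; first exact: expR_gt0.
  move=> eps eps_small p run; have [k [exits kK reg_k]] := terminates p run.
  have [_ ncond _] := exits.
  have [x px bx] := exit_face_ball reg_k (ltW c0_gt0) c0_le ncond.
  have [m [y [ret john le_m]]] := newton_phase bx eps_small.
  by exists k, m, y; split=> //; rewrite px.
- by move=> t; have [sp Dp] := interior_regular (@mult_iter_interior R t);
    exact: simplex_queryable.
- exists (1 / 32), 4, (1 / 144); split; [lra | lra | lra | exact: averaging_rate].
Qed.
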